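(* Let $\mathfrak{h}$ be a finite-dimensional complex Lie algebra and let $\theta\colon\mathfrak{sl}_2(\mathbb{C})\to\mathfrak{gl}(V)$ be a finite-dimensional Lie representation with $V\neq 0$. Then $\mathcal{F}(\mathcal{C}^\bullet\mathfrak{h},\mathfrak{sl}_2)_{(0)}$ equals $\{0\}$ when $H^1(\mathfrak{h})=0$, and otherwise equals the germ at $0$ of $\{\eta\otimes g:\eta\in H^1(\mathfrak{h}),\ g\in\mathfrak{sl}_2\}$ (which is isomorphic to the germ at $0$ of the cone on $\mathbb{P}(H^1(\mathfrak{h}))\times\mathbb{P}(\mathfrak{sl}_2)$). In the first case, for each $i$, $\mathcal{R}^i_1(\mathcal{C}^\bullet\mathfrak{h},\theta)_{(0)}$ is empty if $H^i(\mathfrak{h})=0$ and equals $\{0\}$ otherwise. In the second case, for each $i$, $\mathcal{R}^i_1(\mathcal{C}^\bullet\mathfrak{h},\theta)_{(0)}$ is empty if $H^i(\mathfrak{h})=0$, and otherwise equals the germ at $0$ of $\{\eta\otimes g:\eta\in H^1(\mathfrak{h}),\ g\in\mathfrak{sl}_2,\ \det\theta(g)=0\}$ (the cone on $\mathbb{P}(H^1(\mathfrak{h}))\times\mathbb{P}(V(\det\circ\theta))$).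
   Context: $\mathcal{C}^\bullet\mathfrak{h}=(\bigwedge^\bullet\mathfrak{h}^*,d)$ is the Chevalley–Eilenberg cochain cdga of $\mathfrak{h}$ (with $d\xi(x,y)=-\xi([x,y])$ for $\xi\in\mathfrak{h}^*$, extended as a derivation), and $H^\bullet(\mathfrak{h})$ is its cohomology; $H^1(\mathfrak{h})=\{\eta\in\mathfrak{h}^*: d\eta=0\}$. For a finite-dimensional Lie algebra $\mathfrak{g}$, $\mathcal{F}(A,\mathfrak{g})=\{\omega\in A^1\otimes\mathfrak{g}: d\omega+\frac12[\omega,\omega]=0\}$ (for $\omega=\sum_k\eta_k\otimes g_k$: $\sum_k d\eta_k\otimes g_k+\sum_{k<l}\eta_k\eta_l\otimes[g_k,g_l]=0$). For $\omega\in\mathcal{F}(A,\mathfrak{g})$ and $\theta\colon\mathfrak{g}\to\mathfrak{gl}(V)$, $d_\omega(a\otimes v)=da\otimes v+\sum_k\eta_ka\otimes\theta(g_k)v$ on $A^\bullet\otimes V$, and $\mathcal{R}^i_1(A,\theta)=\{\omega\in\mathcal{F}(A,\mathfrak{g}):H^i(A\otimes V,d_\omega)\neq 0\}$. $V(\det\circ\theta)\subseteq\mathfrak{sl}_2$ is the zero set of $g\mapsto\det\theta(g)$. $X_{(x)}$ denotes the analytic germ of $X$ at $x$. *)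

(* Defs.v *)
From HB Require Import structures.
From mathcomp Require Import all_boot all_order all_algebra all_fingroup.
From mathcomp Require Import complex reals.
Set Implicit Arguments. Unset Strict Implicit. Unset Printing Implicit Defensive.
Import Order.TTheory GRing.Theory Num.Theory.
Local Open Scope ring_scope.

(* A finite-dimensional Lie algebra h is C^n with basis e_0..e_{n-1} and
   structure constants  [e_a, e_b] = \sum_k c a b k e_k. *)
Definition is_lie (C : fieldType) (n : nat) (c : 'I_n -> 'I_n -> 'I_n -> C) : Prop :=
  (forall a b k, c a b k = - c b a k) /\
  (forall a b e k, \sum_(d < n) (c a b d * c d e k + c b e d * c d a k
                                 + c e a d * c d b k) = 0).

Definition lieb (C : fieldType) (m : nat) (A B : 'M[C]_m) : 'M[C]_m := A *m B - B *m A.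

Definition sl2 (C : fieldType) (g : 'M[C]_2) : Prop := \tr g = 0.

(* theta : sl_2 -> gl(V), V = C^m (column vectors); only its values on sl_2 matter *)
Definition sl2_rep (C : fieldType) (m : nat) (theta : 'M[C]_2 -> 'M[C]_m) : Prop :=
  (forall (x y : 'M[C]_2) (s t : C), sl2 x -> sl2 y ->
      theta (s *: x + t *: y) = s *: theta x + t *: theta y) /\
  (forall x y : 'M[C]_2, sl2 x -> sl2 y -> theta (lieb x y) = lieb (theta x) (theta y)).

Section CE.
Variables (C : fieldType) (n : nat) (c : 'I_n -> 'I_n -> 'I_n -> C).

(* W-valued k-cochains on h, given by their values on k-tuples of basis vectors
   (multilinear extension); genuine cochains are the alternating ones. *)
Definition form (W : Type) (k : nat) := ('I_k -> 'I_n) -> W.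

Definition alternating (W : lmodType C) (k : nat) (a : form W k) : Prop :=
  (forall (s : 'S_k) (x : 'I_k -> 'I_n), a (x \o s) = ((-1) ^+ odd_perm s) *: a x) /\
  (forall (x : 'I_k -> 'I_n) (i j : 'I_k), i != j -> x i = x j -> a x = 0).

Definition setidx (k : nat) (x : 'I_k -> 'I_n) (i : 'I_k) (b : 'I_n) : 'I_k -> 'I_n :=
  fun l => if l == i then b else x l.

(* Chevalley-Eilenberg differential (trivial coefficients, applied to W-valued
   cochains, i.e. d(a (x) v) = da (x) v):
   (d a)(x_0..x_k) = sum_{i<j} (-1)^(i+j) a([x_i,x_j], x_0..^i..^j..x_k),
   written equivalently for alternating a as
   sum_{i<j} (-1)^j a(x_0.., [x_i,x_j] (at slot i), ..^j..x_k).
   In degree 1: (d xi)(x,y) = - xi([x,y]). *)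
Definition ce_d (W : lmodType C) (k : nat) (a : form W k) : form W k.+1 :=
  fun x => \sum_(i < k.+1) \sum_(j < k.+1 | (i < j)%N) \sum_(b < n)
             ((-1) ^+ j * c (x i) (x j) b) *: a (setidx x i b \o lift j).

Definition wedge1 (W : lmodType C) (k : nat) (eta : 'I_n -> C) (a : form W k) : form W k.+1 :=
  fun x => \sum_(i < k.+1) ((-1) ^+ i * eta (x i)) *: a (x \o lift i).

Definition oneform (eta : 'I_n -> C) : form C^o 1 := fun x => eta (x ord0).

Definition dual_basis (a : 'I_n) : 'I_n -> C := fun b => (b == a)%:R.

(* eta in h^* is closed, i.e. eta \in H^1(h) *)
Definition closed1 (eta : 'I_n -> C) : Prop := forall x, ce_d (oneform eta) x = 0.

Definition H1_zero : Prop := forall eta, closed1 eta -> forall a, eta a = 0.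

Definition Hnz (W : lmodType C) (D : forall k, form W k -> form W k.+1) (i : nat) : Prop :=
  exists a : form W i, alternating a /\ (forall x, D i a x = 0) /\
    match i as i0 return form W i0 -> Prop with
    | 0 => fun a => exists x, a x != 0
    | p.+1 => fun a => ~ exists b : form W p, alternating b /\ forall x, D p b x = a x
    end a.

Definition Hh_nz (i : nat) : Prop := Hnz (fun k => @ce_d C^o k) i.

(* Elements of A^1 (x) sl_2 = h^* (x) sl_2, written w = sum_a e^a (x) w a. *)
Definition MC (w : 'I_n -> 'M[C]_2) : Prop :=
  (forall a, sl2 (w a)) /\
  forall x : 'I_2 -> 'I_n,
    \sum_(a < n) (ce_d (oneform (dual_basis a)) x : C) *: w a
    + \sum_(a < n) \sum_(b < n | (a < b)%N)
        (wedge1 (dual_basis a) (oneform (dual_basis b)) x : C) *: lieb (w a) (w b) = 0.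

Definition dtw (m : nat) (theta : 'M[C]_2 -> 'M[C]_m) (w : 'I_n -> 'M[C]_2)
    (k : nat) (a : form 'cV[C]_m k) : form 'cV[C]_m k.+1 :=
  fun x => ce_d a x + \sum_(b < n) wedge1 (dual_basis b) (fun y => theta (w b) *m a y) x.

Definition Res (m : nat) (theta : 'M[C]_2 -> 'M[C]_m) (i : nat) (w : 'I_n -> 'M[C]_2) : Prop :=
  MC w /\ Hnz (fun k => @dtw m theta w k) i.

Definition coneS (w : 'I_n -> 'M[C]_2) : Prop :=
  exists (eta : 'I_n -> C) (g : 'M[C]_2), closed1 eta /\ sl2 g /\ forall a, w a = eta a *: g.

Definition coneSdet (m : nat) (theta : 'M[C]_2 -> 'M[C]_m) (w : 'I_n -> 'M[C]_2) : Prop :=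
  exists (eta : 'I_n -> C) (g : 'M[C]_2), closed1 eta /\ sl2 g /\ \det (theta g) = 0 /\
     forall a, w a = eta a *: g.

End CE.

Definition germ_eq (C : numDomainType) (n : nat) (X Y : ('I_n -> 'M[C]_2) -> Prop) : Prop :=
  exists e : C, 0 < e /\
    forall w : 'I_n -> 'M[C]_2, (forall a i j, `|w a i j| < e) -> (X w <-> Y w).

Definition set_empty (C : Type) (n : nat) : ('I_n -> 'M[C]_2) -> Prop := fun _ => False.
Definition set_zero (C : nmodType) (n : nat) : ('I_n -> 'M[C]_2) -> Prop := fun w => forall a, w a = 0.

(* Main.v *)
(* Cartan's formula does all the work. Flat sl_2-connections on h are Lie
   homomorphisms h -> sl_2. If X is in the image of such a map then
   (ad X)^3 = -4 det X (ad X), so that either ad X kills the image, or det X = 0,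
   or -4 det X is an eigenvalue of (ad x)^2 on h; the last case is excluded near 0
   because nonzero eigenvalues are bounded away from 0. As an isotropic subspace
   of sl_2 has dimension at most 1, the image of a small map is commutative, hence
   at most a line.
   For w = eta (x) g put N = theta(g). The operator i_x d_w + d_w i_x is
   L_x + eta(x) N, so on cohomology L_x acts as - eta(x) N. The Cayley-Hamilton
   theorem for L_x then shows, for small w with eta(x) <> 0, that a power of N
   kills H^i(h (x) V, d_w). If N is invertible the cohomology vanishes. If
   H^i(h) = 0, the filtration by the images of the powers of N together with the
   Fitting decomposition of N gives the vanishing. If N is singular and
   H^i(h) <> 0, a nonzero class is built from the kernel and the cokernel of N. *)
Require Import Defs.
From HB Require Import structures.
From mathcomp Require Import all_boot all_order all_algebra all_fingroup.
From mathcomp Require Import complex reals.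
From mathcomp Require Import boolp functions ring.
Import Order.TTheory GRing.Theory Num.Theory.
Local Open Scope ring_scope.
Set Implicit Arguments. Unset Strict Implicit. Unset Printing Implicit Defensive.

Definition icons (n k : nat) (x : 'I_n) (y : 'I_k -> 'I_n) : 'I_k.+1 -> 'I_n :=
  fun i => if unlift ord0 i is Some j then y j else x.

(** * Cochains, contractions and Lie derivatives *)

Section Cochains.
Variables (C : numFieldType) (n : nat) (c : 'I_n -> 'I_n -> 'I_n -> C).
Local Notation cochain := (Defs.form n).
Local Notation lift0 := (lift ord0).

Lemma icons0 k x (y : 'I_k -> 'I_n) : icons x y ord0 = x.
Proof. by rewrite /icons unlift_none. Qed.

Lemma iconsS k x (y : 'I_k -> 'I_n) j : icons x y (lift0 j) = y j.
Proof. by rewrite /icons liftK. Qed.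

Lemma icons_lift0 k x (y : 'I_k -> 'I_n) : icons x y \o lift0 = y.
Proof. by apply: funext => j /=; rewrite iconsS. Qed.

Lemma icons_eta k (z : 'I_k.+1 -> 'I_n) : icons (z ord0) (z \o lift0) = z.
Proof.
by apply: funext => i; case: (unliftP ord0 i) => [j|] ->; rewrite ?iconsS ?icons0.
Qed.

Lemma icons_liftS k x (y : 'I_k.+1 -> 'I_n) j :
  icons x y \o lift (lift0 j) = icons x (y \o lift j).
Proof.
apply: funext => i /=; case: (unliftP ord0 i) => [l|] ->; last first.
  have -> : lift (lift0 j) ord0 = ord0 by apply: val_inj.
  by rewrite !icons0.
have -> : lift (lift0 j) (lift0 l) = lift0 (lift j l).
  by apply: val_inj; rewrite /= /bump /= !add1n ltnS addnS.
by rewrite !iconsS.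
Qed.

Lemma setidx0 k x (y : 'I_k -> 'I_n) b : setidx (icons x y) ord0 b = icons b y.
Proof.
apply: funext => i; rewrite /setidx; case: (unliftP ord0 i) => [j|] ->.
  by rewrite !iconsS.
by rewrite eqxx icons0.
Qed.

Lemma setidxS k x (y : 'I_k -> 'I_n) i b :
  setidx (icons x y) (lift0 i) b = icons x (setidx y i b).
Proof.
apply: funext => l; rewrite /setidx; case: (unliftP ord0 l) => [j|] ->.
  by rewrite !iconsS (inj_eq lift_inj).
by rewrite !icons0.
Qed.

Section Ops.
Variable W : lmodType C.
Implicit Types (k : nat).

Definition ctr k x (a : cochain W k.+1) : cochain W k := fun y => a (icons x y).

(** The coadjoint action of [e_x] on each of the [k] arguments, with trivial action on [W]. *)
Definition lie_der x k (a : cochain W k) : cochain W k :=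
  fun y => \sum_(l < k) \sum_(b < n) - c x (y l) b *: a (setidx y l b).

Lemma ctr_is_linear k x : linear (@ctr k x).
Proof. by move=> t a b; apply: funext. Qed.
HB.instance Definition _ k x := GRing.isLinear.Build C (cochain W k.+1)
  (cochain W k) *:%R (@ctr k x) (@ctr_is_linear k x).

Lemma lie_der_is_linear x k : linear (@lie_der x k).
Proof.
move=> t a b; apply: funext => y; rewrite /lie_der.
rewrite -[RHS]/(_ *: _ + _) scaler_sumr -big_split; apply: eq_bigr => l _ /=.
rewrite scaler_sumr -big_split; apply: eq_bigr => e _ /=.
by rewrite scalerDr !scalerA mulrC.
Qed.
HB.instance Definition _ x k := GRing.isLinear.Build C (cochain W k)
  (cochain W k) *:%R (@lie_der x k) (@lie_der_is_linear x k).

Lemma ce_d_is_linear k : linear (@ce_d C n c W k).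
Proof.
move=> t a b; apply: funext => y; rewrite /ce_d.
rewrite -[RHS]/(_ *: _ + _) scaler_sumr -big_split; apply: eq_bigr => l _ /=.
rewrite scaler_sumr -big_split; apply: eq_bigr => j _ /=.
rewrite scaler_sumr -big_split; apply: eq_bigr => e _ /=.
by rewrite scalerDr !scalerA [t * _]mulrC.
Qed.
HB.instance Definition _ k := GRing.isLinear.Build C (cochain W k)
  (cochain W k.+1) *:%R (@ce_d C n c W k) (@ce_d_is_linear k).

Lemma wedge1_is_linear (eta : 'I_n -> C) k : linear (@wedge1 C n W k eta).
Proof.
move=> t a b; apply: funext => y; rewrite /wedge1.
rewrite -[RHS]/(_ *: _ + _) scaler_sumr -big_split; apply: eq_bigr => l _ /=.
by rewrite scalerDr !scalerA [t * _]mulrC.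
Qed.
HB.instance Definition _ eta k := GRing.isLinear.Build C (cochain W k)
  (cochain W k.+1) *:%R (@wedge1 C n W k eta) (@wedge1_is_linear eta k).

(** Makes induction on the degree possible: identities are checked after contraction with each basis
    vector. *)
Lemma ctr_ext k (a b : cochain W k.+1) : (forall x, ctr x a = ctr x b) -> a = b.
Proof.
by move=> h; apply: funext => z; rewrite -(icons_eta z) -/(ctr _ a _) h.
Qed.

Lemma lie_der0 x (a : cochain W 0) : lie_der x a = 0.
Proof. by apply: funext => y; rewrite /lie_der big_ord0. Qed.

(** Slot 0 contributes the contraction with [[x, y]], the other slots contribute [L_x i_y]. *)
Lemma ctr_lie_der k x y (a : cochain W k.+1) :
  ctr y (lie_der x a) = lie_der x (ctr y a) - \sum_b c x y b *: ctr b a.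
Proof.
apply: funext => z; rewrite /ctr /lie_der big_ord_recl addrC.
rewrite -[RHS]/(_ + - ((\sum_b _) z)) fct_sumE -sumrN; congr (_ + _).
  apply: eq_bigr => l _; apply: eq_bigr => b _.
  by rewrite iconsS setidxS.
by apply: eq_bigr => b _; rewrite icons0 setidx0 scaleNr.
Qed.

Lemma ctr_wedge1_0 x eta (a : cochain W 0) : ctr x (wedge1 eta a) = eta x *: a.
Proof.
apply: funext => y; rewrite /ctr /wedge1 big_ord1 expr0 mul1r icons0.
by rewrite icons_lift0.
Qed.

Lemma ctr_wedge1 k x eta (a : cochain W k.+1) :
  ctr x (wedge1 eta a) = eta x *: a - wedge1 eta (ctr x a).
Proof.
apply: funext => y; rewrite /ctr /wedge1 big_ord_recl expr0 mul1r icons0.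
rewrite icons_lift0; congr (_ + _); rewrite -[RHS]/(- (\sum_(i < _) _)) -sumrN.
apply: eq_bigr => i _; rewrite iconsS icons_liftS -scaleNr exprS mulN1r.
by rewrite mulNr.
Qed.

Definition ctr_swap k : cochain W k -> Prop :=
  match k return cochain W k -> Prop with
  | k'.+2 => fun a => forall x y, ctr x (ctr y a) = - ctr y (ctr x a)
  | _ => fun=> True
  end.

(** Alternation in a form suited to induction by contraction; [alternatingP] identifies it with
    [alternating]. *)
Fixpoint alt k : cochain W k -> Prop :=
  match k return cochain W k -> Prop with
  | 0 => fun=> True
  | k'.+1 => fun a => (forall x, alt (ctr x a)) /\ ctr_swap a
  end.

Lemma altS k (a : cochain W k.+1) : alt a -> forall x, alt (ctr x a).
Proof. by case. Qed.

Lemma alt0 k : alt (0 : cochain W k).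
Proof.
elim: k => // k IH; split; first by move=> x; rewrite linear0.
by case: k {IH} => // k x y; rewrite !linear0.
Qed.

Lemma altDZ k t (a b : cochain W k) : alt a -> alt b -> alt (t *: a + b).
Proof.
elim: k a b => // k IH a b [altA swA] [altB swB]; split.
  by move=> x; rewrite linearP; apply: IH; [exact: altA|exact: altB].
case: k a b swA swB {IH altA altB} => // k a b swA swB x y.
by rewrite !linearP /= swA swB.
Qed.

Lemma altD k (a b : cochain W k) : alt a -> alt b -> alt (a + b).
Proof. by move=> hA hB; rewrite -[a]scale1r; apply: altDZ. Qed.

Lemma altZ k t (a : cochain W k) : alt a -> alt (t *: a).
Proof. by move=> hA; rewrite -[_ *: _]addr0; apply: altDZ => //; apply: alt0. Qed.

Lemma altN k (a : cochain W k) : alt a -> alt (- a).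
Proof. by rewrite -scaleN1r; apply: altZ. Qed.

Lemma altB k (a b : cochain W k) : alt a -> alt b -> alt (a - b).
Proof. by move=> hA hB; apply: altD => //; apply: altN. Qed.

Lemma alt_sum k (I : finType) (F : I -> cochain W k) :
  (forall i, alt (F i)) -> alt (\sum_i F i).
Proof. by move=> hF; apply: (big_ind (@alt k)) => //; [exact: alt0|exact: altD]. Qed.

(** The value [b] passes [j] entries on its way from slot 0 to slot [j], each at the cost of a sign.
    This reconciles the position of the bracket in [ce_d] with that in [lie_der]. *)
Lemma alt_ins k (a : cochain W k.+1) b (y : 'I_k.+1 -> 'I_n) j : alt a ->
  a (icons b (y \o lift j)) = (-1) ^+ j *: a (setidx y j b).
Proof.
elim: k a b y j => [|k IH] a b y j hA; case: (unliftP ord0 j) => [i|] ->.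
- by case: i.
- by rewrite expr0 scale1r -{2}(icons_eta y) setidx0.
- have [x [z ->]] : exists x z, y = icons x z.
    by exists (y ord0), (y \o lift0); rewrite icons_eta.
  case: hA => hA sw; rewrite icons_liftS setidxS.
  rewrite -[LHS]/(ctr x (ctr b a) (z \o lift i)) sw -[LHS]/(- _) {1}/ctr.
  by rewrite (IH (ctr x a)) //= exprS mulN1r scaleNr.
- by rewrite expr0 scale1r -{2}(icons_eta y) setidx0.
Qed.

Lemma ctr_ce_d0 x (a : cochain W 0) : ctr x (ce_d c a) = 0.
Proof.
apply: funext => y; rewrite /ctr /ce_d big_ord1 big1 // => j.
by rewrite (ord1 j).
Qed.

(* Cartan's formula [i_x d = L_x - d i_x]. *)
Lemma ctr_ce_d k x (a : cochain W k.+1) : alt a ->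
  ctr x (ce_d c a) = lie_der x a - ce_d c (ctr x a).
Proof.
move=> hA; apply: funext => y; rewrite -[RHS]/(lie_der x a y - ce_d c (ctr x a) y).
rewrite {1}/ctr /ce_d big_ord_recl; congr (_ + _).
  (* The terms with first index 0 have [[x, y_j]] in slot 0; [alt_ins] takes it to slot [j], and the
     signs multiply to -1. *)
  rewrite big_mkcond big_ord_recl /= add0r /lie_der.
  apply: eq_bigr => j _; apply: eq_bigr => b _ /=.
  rewrite icons0 iconsS setidx0 icons_liftS alt_ins // scalerA exprS.
  by rewrite mulN1r !mulNr mulrAC -expr2 sqrr_sign mul1r.
rewrite -sumrN; apply: eq_bigr => i _; rewrite big_mkcond big_ord_recl /=.
rewrite add0r -sumrN [RHS]big_mkcond; apply: eq_bigr => j _.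
rewrite /= !/bump /= !add1n ltnS; case: ifP => // _; rewrite -sumrN.
apply: eq_bigr => b _; rewrite !iconsS setidxS icons_liftS exprS mulN1r.
by rewrite mulNr scaleNr.
Qed.

End Ops.
End Cochains.

(** * Cartan calculus on alternating cochains *)

Section LieCochains.
Variables (C : numFieldType) (n : nat) (c : 'I_n -> 'I_n -> 'I_n -> C).
Hypothesis hL : is_lie c.
Local Notation cochain := (Defs.form n).

(* [linearB] and the like also match [-%R] and [*:%R], so that the operators
   get their own rewriting rules. *)
Lemma ctr_lin (W : lmodType C) k x :
  ((forall a b : cochain W k.+1, (ctr x (a + b) = ctr x a + ctr x b)%R)
  * (forall a : cochain W k.+1, (ctr x (- a) = - ctr x a)%R)
  * (forall t (a : cochain W k.+1), (ctr x (t *: a) = t *: ctr x a)%R)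
  * (forall F : 'I_n -> cochain W k.+1,
       (ctr x (\sum_i F i) = \sum_i ctr x (F i))%R))%type.
Proof.
by split; [split; [split; [exact: linearD|exact: linearN]|]|] => *;
  [rewrite linearZ|rewrite linear_sum].
Qed.

Lemma ctr_0 (W : lmodType C) k x : ctr x (0 : cochain W k.+1) = 0.
Proof. by []. Qed.

Lemma lie_der_lin (W : lmodType C) k x :
  ((forall a b : cochain W k, (lie_der c x (a + b) = lie_der c x a + lie_der c x b)%R)
  * (forall a : cochain W k, (lie_der c x (- a) = - lie_der c x a)%R)
  * (forall t (a : cochain W k), (lie_der c x (t *: a) = t *: lie_der c x a)%R)
  * (forall F : 'I_n -> cochain W k,
       (lie_der c x (\sum_i F i) = \sum_i lie_der c x (F i))%R))%type.
Proof.
by split; [split; [split; [exact: linearD|exact: linearN]|]|] => *;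
  [rewrite linearZ|rewrite linear_sum].
Qed.

Lemma ce_d_lin (W : lmodType C) k :
  ((forall a b : cochain W k, (ce_d c (a + b) = ce_d c a + ce_d c b)%R)
  * (forall a : cochain W k, (ce_d c (- a) = - ce_d c a)%R)
  * (forall t (a : cochain W k), (ce_d c (t *: a) = t *: ce_d c a)%R)
  * (forall F : 'I_n -> cochain W k,
       (ce_d c (\sum_i F i) = \sum_i ce_d c (F i))%R))%type.
Proof.
by split; [split; [split; [exact: linearD|exact: linearN]|]|] => *;
  [rewrite linearZ|rewrite linear_sum].
Qed.

Lemma wedge1_lin (W : lmodType C) eta k :
  ((forall a b : cochain W k, (wedge1 eta (a + b) = wedge1 eta a + wedge1 eta b)%R)
  * (forall a : cochain W k, (wedge1 eta (- a) = - wedge1 eta a)%R)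
  * (forall t (a : cochain W k), (wedge1 eta (t *: a) = t *: wedge1 eta a)%R)
  * (forall F : 'I_n -> cochain W k,
       (wedge1 eta (\sum_i F i) = \sum_i wedge1 eta (F i))%R))%type.
Proof.
by split; [split; [split; [exact: linearD|exact: linearN]|]|] => *;
  [rewrite linearZ|rewrite linear_sum].
Qed.

Lemma alt_lie_der (W : lmodType C) x k (a : cochain W k) :
  alt a -> alt (lie_der c x a).
Proof.
elim: k a => // k IH a hA; split=> [y|].
  rewrite ctr_lie_der; apply: altB; first by apply/IH/altS.
  by apply: alt_sum => b; apply/altZ/altS.
case: k {IH} a hA => // k a [_ sw] y z.
rewrite !ctr_lie_der !ctr_lin !ctr_lie_der (sw y z) lie_der_lin.
rewrite !opprB [RHS]addrA [RHS]addrC [RHS]addrA.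
congr (_ + _ + _); rewrite -sumrN; apply: eq_bigr => b _.
  by rewrite ctr_lin -scalerN -(sw z b).
by rewrite ctr_lin (sw y b) scalerN opprK.
Qed.

(** [L] is a representation: after contraction with [z], the induction hypothesis settles the double
    Lie derivatives, the mixed terms cancel, and the Jacobi identity settles the rest. *)
Lemma lie_der_comm (W : lmodType C) x y k (a : cochain W k) :
  lie_der c x (lie_der c y a) - lie_der c y (lie_der c x a)
  = \sum_b c x y b *: lie_der c b a.
Proof.
elim: k a => [|k IH] a.
  by rewrite !lie_der0 subr0 big1 // => b _; rewrite lie_der0 scaler0.
apply: ctr_ext => z; rewrite !ctr_lin.
under [RHS]eq_bigr => b _ do rewrite ctr_lin ctr_lie_der scalerBr.
rewrite big_split -IH /= !ctr_lie_der !lie_der_lin.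
under [\sum_b c x z b *: _]eq_bigr => b _ do rewrite ctr_lie_der scalerBr.
under [\sum_b c y z b *: ctr b _]eq_bigr => b _ do rewrite ctr_lie_der scalerBr.
under [\sum_b lie_der c x _]eq_bigr => b _ do rewrite lie_der_lin.
under [\sum_b lie_der c y _]eq_bigr => b _ do rewrite lie_der_lin.
rewrite !big_split /= !sumrN.
set P := lie_der c x (lie_der c y _); set Q := lie_der c y (lie_der c x _).
set S1 := \sum_b _ *: lie_der c x _; set S2 := \sum_b _ *: lie_der c y _.
set T1 := \sum_b _ *: \sum_e c y b e *: _.
set T2 := \sum_b _ *: \sum_e c x b e *: _.
have -> : P - S1 - (S2 - T1) - (Q - S2 - (S1 - T2)) = P - Q + (T1 - T2).
  rewrite -!addrA; congr (_ + _); rewrite !opprB !opprD !opprK -!addrA.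
  rewrite !addrA [LHS](ACl ((1*7)*(5*3)*(4*(2*6)))) /= addNr subrr.
  by rewrite !add0r addrA.
congr (_ + _).
have sw (u : 'I_n -> C) (v : 'I_n -> 'I_n -> C) :
    \sum_b u b *: \sum_e v b e *: ctr e a = \sum_e (\sum_b u b * v b e) *: ctr e a.
  under eq_bigr => b _ do rewrite scaler_sumr.
  rewrite exchange_big; apply: eq_bigr => e _ /=; rewrite scaler_suml.
  by apply: eq_bigr => b _; rewrite scalerA.
rewrite /T1 /T2 !sw -!sumrB -sumrN; apply: eq_bigr => e _.
rewrite -scalerBl -scaleNr; congr (_ *: _); case: hL => cA cJ.
apply/eqP; rewrite -subr_eq0 opprK -sumrB -big_split; apply/eqP; rewrite -[RHS](cJ x y z e).
apply: eq_bigr => b _ /=; rewrite (cA b x e) (cA z x b) (cA b y e); ring.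
Qed.

Lemma alt_wedge1 (W : lmodType C) eta k (a : cochain W k) :
  alt a -> alt (wedge1 eta a).
Proof.
elim: k a => [|k IH] a hA; first by split.
split=> [x|x y].
- rewrite ctr_wedge1; apply: altB; first exact: altZ.
  exact/IH/altS.
- case: k {IH} a hA => [|k] a hA.
    by rewrite !ctr_wedge1 !ctr_lin !ctr_wedge1_0 opprB.
  rewrite !ctr_wedge1 !ctr_lin !ctr_wedge1; case: hA => _ -> .
  by rewrite wedge1_lin !opprB addrA.
Qed.

(** Cartan's formula, applied twice, makes [i_x i_y d a] antisymmetric in [x] and [y], because the
    bracket and [i_x i_y a] are. *)
Lemma alt_ce_d (W : lmodType C) k (a : cochain W k) : alt a -> alt (ce_d c a).
Proof.
elim: k a => [|k IH] a hA; first by split=> // x; rewrite ctr_ce_d0.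
split=> [x|x y].
- rewrite ctr_ce_d //; apply: altB; first exact: alt_lie_der.
  exact/IH/altS.
- case: k {IH} a hA => [|k] a hA.
    rewrite !ctr_ce_d // !ctr_lin !ctr_lie_der !ctr_ce_d0 !subr0 !lie_der0.
    rewrite !sub0r opprK -sumrN; apply: eq_bigr => b _.
    by rewrite (hL.1 y) scaleNr opprK.
  rewrite !ctr_ce_d // !ctr_lin !ctr_lie_der !ctr_ce_d; last by apply: altS.
  2: by apply: altS.
  case: (hA) => _ ->; rewrite ce_d_lin.
  under [in RHS]eq_bigr => b _ do rewrite (hL.1 x) scaleNr.
  rewrite sumrN !opprK opprB !opprD !addrA.
  by rewrite [RHS](ACl (1*4*3*2)).
Qed.

(** Cartan's formula on both sides leaves a commutator of Lie derivatives, which [lie_der_comm]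
    evaluates. *)
Lemma lie_der_ce_d (W : lmodType C) x k (a : cochain W k) : alt a ->
  lie_der c x (ce_d c a) = ce_d c (lie_der c x a).
Proof.
elim: k a => [|k IH] a hA; apply: ctr_ext => y.
  rewrite ctr_lie_der !ctr_ce_d0 lie_der0 big1 ?subr0 // => b _.
  by rewrite ctr_ce_d0 scaler0.
rewrite ctr_lie_der !ctr_ce_d //; last exact: alt_lie_der.
under eq_bigr => b _ do rewrite ctr_ce_d // scalerBr.
rewrite ctr_lie_der !lie_der_lin !ce_d_lin IH; last exact: altS.
under [X in _ = _ - (_ - X)]eq_bigr => b _ do rewrite ce_d_lin.
rewrite big_split /= sumrN -lie_der_comm.
by rewrite !opprB !addrA [LHS](ACl ((1*5)*(4*3*2))) /= subrr add0r.
Qed.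

(** By Cartan's formula [i_x d d a = d d i_x a], and the degree drops. *)
Lemma ce_d_ce_d (W : lmodType C) k (a : cochain W k) : alt a ->
  ce_d c (ce_d c a) = 0.
Proof.
elim: k a => [|k IH] a hA; apply: ctr_ext => x; rewrite ctr_0.
  rewrite ctr_ce_d; last exact: alt_ce_d.
  by rewrite ctr_ce_d0 lie_der_ce_d // lie_der0 subrr.
rewrite ctr_ce_d; last exact: alt_ce_d.
rewrite ctr_ce_d // !ce_d_lin lie_der_ce_d // (IH (ctr x a)); last exact: altS.
by rewrite oppr0 addr0 subrr.
Qed.

Lemma wedge1_wedge1 (W : lmodType C) eta k (a : cochain W k) :
  wedge1 eta (wedge1 eta a) = 0.
Proof.
elim: k a => [|k IH] a; apply: ctr_ext => x; rewrite !ctr_wedge1 ctr_0.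
  by rewrite ctr_wedge1_0 wedge1_lin subrr.
by rewrite !wedge1_lin IH oppr0 addr0 subrr.
Qed.

Section ClosedForm.
Variable eta : 'I_n -> C.
(** Closedness in coordinates: [eta] vanishes on brackets, see [closed1P]. *)
Hypothesis eta_closed : forall x y, \sum_b c x y b * eta b = 0.

Lemma lie_der_wedge1 (W : lmodType C) x k (a : cochain W k) :
  lie_der c x (wedge1 eta a) = wedge1 eta (lie_der c x a).
Proof.
elim: k a => [|k IH] a; apply: ctr_ext => y.
  rewrite ctr_lie_der !ctr_wedge1_0 !lie_der0 scaler0 sub0r.
  under eq_bigr => b _ do rewrite ctr_wedge1_0 scalerA.
  by rewrite -scaler_suml eta_closed scale0r oppr0.
rewrite ctr_lie_der !ctr_wedge1 ctr_lie_der.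
under eq_bigr => b _ do rewrite ctr_wedge1 scalerBr scalerA.
rewrite big_split /= -scaler_suml eta_closed scale0r add0r sumrN opprK.
rewrite !lie_der_lin !wedge1_lin IH opprB -addrA; congr (_ + _).
rewrite addrC; congr (_ - _); apply: eq_bigr => b _.
by rewrite wedge1_lin.
Qed.

Lemma ce_d_wedge1 (W : lmodType C) k (a : cochain W k) : alt a ->
  ce_d c (wedge1 eta a) = - wedge1 eta (ce_d c a).
Proof.
elim: k a => [|k IH] a hA; apply: ctr_ext => x; rewrite ctr_lin.
  rewrite ctr_ce_d; last exact: alt_wedge1.
  rewrite lie_der_wedge1 ctr_wedge1 ctr_wedge1_0 ctr_ce_d0 lie_der0 ce_d_lin.
  by rewrite opprB.
rewrite ctr_ce_d; last exact: alt_wedge1.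
rewrite lie_der_wedge1 !ctr_wedge1 ce_d_lin ce_d_lin ctr_ce_d //.
rewrite ce_d_lin IH; last exact: altS.
by rewrite !wedge1_lin !opprK opprB opprD addrA addrAC.
Qed.
End ClosedForm.

End LieCochains.

(** * Change of coefficients along a linear map *)

Section Postcomposition.
Variables (C : numFieldType) (n : nat) (c : 'I_n -> 'I_n -> 'I_n -> C).
Variables (W W' : lmodType C) (f : {linear W -> W'}).
Local Notation cochain := (Defs.form n).

Definition fpost k (a : cochain W k) : cochain W' k := fun y => f (a y).

Lemma lie_der_post x k (a : cochain W k) :
  lie_der c x (fpost a) = fpost (lie_der c x a).
Proof.
apply: funext => y; rewrite /fpost /lie_der linear_sum; apply: eq_bigr => l _.
by rewrite linear_sum; apply: eq_bigr => b _; rewrite linearZ.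
Qed.

Lemma ce_d_post k (a : cochain W k) : ce_d c (fpost a) = fpost (ce_d c a).
Proof.
apply: funext => y; rewrite /fpost /ce_d linear_sum; apply: eq_bigr => l _.
rewrite linear_sum; apply: eq_bigr => j _.
by rewrite linear_sum; apply: eq_bigr => b _; rewrite linearZ.
Qed.

Lemma wedge1_post eta k (a : cochain W k) :
  wedge1 eta (fpost a) = fpost (wedge1 eta a).
Proof.
apply: funext => y; rewrite /fpost /wedge1 linear_sum; apply: eq_bigr => l _.
by rewrite linearZ.
Qed.

Lemma alt_post k (a : cochain W k) : alt a -> alt (fpost a).
Proof.
elim: k a => // k IH a hA; split=> [x|]; first exact/(IH (ctr x a))/altS.
case: k {IH} a hA => // k a [_ sw] x y.
apply: funext => z; rewrite -[LHS]/(f (ctr x (ctr y a) z)) sw.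
exact: linearN.
Qed.

End Postcomposition.

(** * Equivalence of the two descriptions of alternation *)

Section Alternating.
Variables (C : numFieldType) (n : nat) (W : lmodType C).
Local Notation cochain := (Defs.form n).
Local Notation lift0 := (lift ord0).

Lemma alternating_ctr k x (a : cochain W k.+1) :
  alternating a -> alternating (ctr x a).
Proof.
case=> hs hr; split=> [s y|y i j neq_ij eq_y].
  rewrite /ctr -[odd_perm s]/(false (+) false (+) odd_perm s).
  rewrite -(odd_lift_perm ord0 ord0 s) -hs; congr (a _).
  apply: funext => i /=; case: (unliftP ord0 i) => [j|] ->.
    by rewrite lift_perm_lift !iconsS.
  by rewrite lift_perm_id !icons0.
apply: (hr _ (lift0 i) (lift0 j)); first by rewrite (inj_eq lift_inj).
by rewrite !iconsS.
Qed.

Lemma alternating_alt k (a : cochain W k) : alternating a -> alt a.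
Proof.
elim: k a => // k IH a hA; split=> [x|]; first exact/IH/alternating_ctr.
case: k {IH} a hA => // k a [hs _] x y; apply: funext => z.
rewrite -[RHS]/(- a (icons x (icons y z))) -[LHS]/(a (icons y (icons x z))).
have := hs (tperm ord0 (lift0 ord0)) (icons x (icons y z)).
rewrite odd_tperm /= expr1 scaleN1r => <-; congr (a _).
apply: funext => i /=; case: tpermP => [->|->|].
- by rewrite icons0 iconsS icons0.
- by rewrite icons0 iconsS icons0.
case: (unliftP ord0 i) => [j|] -> // _; rewrite !iconsS.
by case: (unliftP ord0 j) => [l|] -> //; rewrite !iconsS.
Qed.

(** Transpositions away from slot 0 come from the contraction by induction, that of slots 0 and 1
    from [ctr_swap], and the others by conjugation. *)
Lemma alt_tperm k (a : cochain W k) (i j : 'I_k) y : alt a -> i != j ->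
  a (y \o tperm i j) = - a y.
Proof.
elim: k a i j y => [|k IH] a i j y hA; first by case: i.
have tS i' j' z : i' != j' -> a (z \o tperm (lift0 i') (lift0 j')) = - a z.
  move=> neq; rewrite -(icons_eta z) -[RHS]/(- ctr (z ord0) a (z \o lift0)).
  rewrite -(IH _ i' j') //; last exact: altS.
  rewrite /ctr; congr (a _); apply: funext => l /=.
  case: (unliftP ord0 l) => [l'|] ->.
    by rewrite -inj_tperm ?iconsS //=; exact: lift_inj.
  by rewrite tpermD ?icons0 // eq_sym neq_lift.
have t0 j' z : a (z \o tperm ord0 (lift0 j')) = - a z.
  case: k {IH y} a hA i j j' tS z => [|k] a hA i j j' tS z; first by case: j'.
  have t01 z' : a (z' \o tperm ord0 (lift0 ord0)) = - a z'.
    have := hA.2 (z' ord0) (z' (lift0 ord0)).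
    move/(congr1 (@^~ (z' \o lift0 \o lift0))); rewrite -[RHS]/(- a _) /ctr.
    rewrite -[X in - a (icons _ (icons X _))]/((z' \o lift0) ord0) !icons_eta.
    move=> <-; congr (a _); apply: funext => i' /=.
    case: (unliftP ord0 i') => [l|] ->; last by rewrite tpermL icons0.
    rewrite iconsS; case: (unliftP ord0 l) => [l'|] ->.
      by rewrite tpermD ?iconsS // (inj_eq lift_inj).
    by rewrite tpermR icons0.
  have [->|neq] := eqVneq j' ord0; first exact: t01.
  pose u := tperm (ord0 : 'I_k.+2) (lift0 ord0).
  rewrite (_ : z \o _ = ((z \o u) \o tperm (lift0 ord0) (lift0 j')) \o u).
    by rewrite t01 tS 1?eq_sym // t01 opprK.
  apply: funext => l /=; congr (z _).
  have -> : tperm ord0 (lift0 j') = (tperm (lift0 ord0) (lift0 j') ^ u)%g.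
    by rewrite tpermJ /u tpermR tpermD // (inj_eq lift_inj) eq_sym.
  by rewrite conjgE /u tpermV !permM.
case: (unliftP ord0 i) => [i'|] ->; case: (unliftP ord0 j) => [j'|] -> neq.
- by apply: tS; rewrite (inj_eq lift_inj) in neq.
- by rewrite tpermC t0.
- by rewrite t0.
- by rewrite eqxx in neq.
Qed.

Lemma alternatingP k (a : cochain W k) : alternating a <-> alt a.
Proof.
split=> [|hA]; first exact: alternating_alt.
split=> [s y|y i j neq eq_y].
  have [ts -> /= ] := prod_tpermP s.
  elim: ts y => [|t ts IH] y /=.
    move=> _; rewrite big_nil odd_perm1 scale1r; congr (a _).
    by apply: funext => i; rewrite /= perm1.
  case/andP=> neq hts; rewrite big_cons odd_mul_tperm neq.
  rewrite (_ : y \o _ = (y \o (\prod_(t0 <- ts) tperm t0.1 t0.2)%g) \o tperm t.1 t.2).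
    by rewrite alt_tperm // IH // signrN scaleNr.
  by apply: funext => i; rewrite /= permM.
(* The transposition of two equal entries fixes [y], so [a y = - a y], and 2 is invertible. *)
have := alt_tperm y hA neq; rewrite (_ : y \o _ = y); last first.
  by apply: funext => l /=; case: tpermP => [->|->|].
move/eqP; rewrite -subr_eq0 opprK -mulr2n -scaler_nat scaler_eq0 pnatr_eq0.
by move/eqP.
Qed.
End Alternating.

(** * The twisted differential *)

Section Twisted.
Variables (C : numFieldType) (n : nat) (c : 'I_n -> 'I_n -> 'I_n -> C).
Hypothesis hL : is_lie c.
Variables (eta : 'I_n -> C).
Hypothesis eta_closed : forall x y, \sum_b c x y b * eta b = 0.
Variables (m : nat).
Local Notation cochain := (Defs.form n 'cV[C]_m).

Definition mulf (N : 'M[C]_m) k (a : cochain k) : cochain k := fpost (mulmx N) a.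

(** The differential [d_w] of [w = eta (x) g], with [N] in the place of [theta g]; see [dtwE]. *)
Definition twd (N : 'M[C]_m) k (a : cochain k) : cochain k.+1 :=
  ce_d c a + wedge1 eta (mulf N a).

Lemma mulfM M N k (a : cochain k) : mulf M (mulf N a) = mulf (M *m N) a.
Proof. by apply: funext => y; exact: mulmxA. Qed.

Lemma mulf_lin M k : ((forall a b : cochain k, (mulf M (a + b) = mulf M a + mulf M b)%R)
  * (forall a : cochain k, (mulf M (- a) = - mulf M a)%R)
  * (forall t (a : cochain k), (mulf M (t *: a) = t *: mulf M a)%R))%type.
Proof.
split; [split|] => *; apply: funext => y.
- exact: mulmxDr.
- exact: mulmxN.
- by rewrite [LHS]/= /mulf /fpost -[LHS]/(_ *m (_ *: _)) -scalemxAr.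
Qed.

Lemma mulf1 k (a : cochain k) : mulf 1%:M a = a.
Proof. by apply: funext => y; exact: mul1mx. Qed.

Lemma ce_d_mulf M k (a : cochain k) : ce_d c (mulf M a) = mulf M (ce_d c a).
Proof. exact: ce_d_post. Qed.

Lemma wedge1_mulf M k (a : cochain k) :
  wedge1 eta (mulf M a) = mulf M (wedge1 eta a).
Proof. exact: wedge1_post. Qed.

Lemma lie_der_mulf M x k (a : cochain k) :
  lie_der c x (mulf M a) = mulf M (lie_der c x a).
Proof. exact: lie_der_post. Qed.

Lemma alt_mulf M k (a : cochain k) : alt a -> alt (mulf M a).
Proof. exact: alt_post. Qed.

Lemma twd_lin N k : ((forall a b : cochain k, (twd N (a + b) = twd N a + twd N b)%R)
  * (forall a : cochain k, (twd N (- a) = - twd N a)%R)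
  * (forall t (a : cochain k), (twd N (t *: a) = t *: twd N a)%R))%type.
Proof.
split; [split|] => *; rewrite /twd ce_d_lin mulf_lin wedge1_lin.
- exact: addrACA.
- by rewrite opprD.
- by rewrite scalerDr.
Qed.

Lemma mulf_0 M k : mulf M (0 : cochain k) = 0.
Proof. by apply: funext => y; exact: mulmx0. Qed.

Lemma twd_0 N k : twd N (0 : cochain k) = 0.
Proof. by have := (twd_lin N k).2 0 0; rewrite !scale0r. Qed.

Lemma twd_mulf N M k (a : cochain k) : M *m N = N *m M ->
  twd N (mulf M a) = mulf M (twd N a).
Proof.
move=> comm; rewrite /twd mulf_lin mulfM -comm -mulfM.
by rewrite ce_d_mulf !wedge1_mulf.
Qed.

(** Flatness comes from [d eta = 0] and [eta /\ eta = 0]. *)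
Lemma twd_twd N k (a : cochain k) : alt a -> twd N (twd N a) = 0.
Proof.
move=> hA; rewrite /twd ce_d_lin ce_d_ce_d // add0r mulf_lin wedge1_lin.
rewrite ce_d_wedge1 //; last exact: alt_mulf.
by rewrite ce_d_mulf -wedge1_mulf wedge1_wedge1 addr0 addNr.
Qed.

Lemma ctr_twd0 N x (a : cochain 0) : ctr x (twd N a) = eta x *: mulf N a.
Proof. by rewrite /twd ctr_lin ctr_ce_d0 ctr_wedge1_0 add0r. Qed.

Lemma ctr_twd N x k (a : cochain k.+1) : alt a ->
  ctr x (twd N a) = lie_der c x a + eta x *: mulf N a - twd N (ctr x a).
Proof.
move=> hA; rewrite /twd ctr_lin ctr_ce_d // ctr_wedge1 opprD addrACA.
by [].
Qed.

Lemma lie_der_twd N x k (a : cochain k) : alt a ->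
  lie_der c x (twd N a) = twd N (lie_der c x a).
Proof.
move=> hA; rewrite /twd lie_der_lin lie_der_ce_d // lie_der_wedge1 //.
by rewrite lie_der_mulf.
Qed.

Lemma dtwE theta (w : 'I_n -> 'M[C]_2) N k (a : cochain k) :
  (forall b, theta (w b) = eta b *: N) -> dtw c theta w a = twd N a.
Proof.
move=> hw; apply: funext => x; rewrite /dtw /twd; congr (_ + _).
rewrite /wedge1 exchange_big; apply: eq_bigr => i _ /=.
rewrite (bigD1 (x i)) //= big1 ?addr0 => [|b neq].
  by rewrite /dual_basis eqxx mulr1 hw -scalemxAl scalerA.
by rewrite /dual_basis eq_sym (negPf neq) mulr0 scale0r.
Qed.
End Twisted.

(** * Spectral lemmas *)

Section Spectral.
Variable C : numClosedFieldType.

(** Cayley-Hamilton over an algebraically closed field, factored so that an induction can absorb one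
    root at a time. *)
Lemma mx_annihilating_roots K (A : 'M[C]_K) :
  exists rs : seq C, foldr (fun r M => (A - r%:M) *m M) 1%:M rs = 0.
Proof.
case: K A => [|K] A; first by exists [::]; rewrite [LHS]flatmx0.
have [rs hrs] := closed_field_poly_normal (char_poly A).
exists rs; have := Cayley_Hamilton A; rewrite {1}hrs.
rewrite (monicP (char_poly_monic A)) scale1r rmorph_prod => <-.
elim: rs {hrs} => [|r rs /= ->]; first by rewrite big_nil.
by rewrite big_cons /= rmorphB /= horner_mx_X horner_mx_C.
Qed.

(** The coefficients [L] alone determine the roots, which therefore serve every module [W] and every
    family [a]. *)
Lemma annihilating_roots (T : finType) (L : T -> T -> C) : exists rs : seq C,
  forall (W : lmodType C) (a : T -> W),
  foldr (fun r b => (fun t => \sum_s L t s *: b s - r *: b t)) a rs = fun=> 0.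
Proof.
have [rs hrs] := mx_annihilating_roots
  (\matrix_(i < #|T|, j < #|T|) L (enum_val i) (enum_val j)).
exists rs => W a; move: hrs; set A := \matrix_(i, j) _.
pose act (M : 'M[C]_#|T|) t := \sum_s M (enum_rank t) (enum_rank s) *: a s.
have act1 : act 1%:M = a.
  apply: funext => t; rewrite /act (bigD1 t) //= mxE eqxx scale1r big1 ?addr0 //.
  by move=> s neq; rewrite mxE (inj_eq enum_rank_inj) eq_sym (negPf neq) scale0r.
have actM r M t : act ((A - r%:M) *m M) t = \sum_s L t s *: act M s - r *: act M t.
  rewrite /act; under [in RHS]eq_bigr => s _ do rewrite scaler_sumr.
  rewrite exchange_big scaler_sumr -sumrB; apply: eq_bigr => s _ /=.
  rewrite mulmxBl mul_scalar_mx !mxE scalerBl scalerA; congr (_ - _).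
  rewrite (reindex (@enum_rank T)) /=; last exact/onW_bij/enum_rank_bij.
  by rewrite scaler_suml; apply: eq_bigr => u _; rewrite mxE !enum_rankK scalerA.
move=> hrs; transitivity (act (foldr (fun r M => (A - r%:M) *m M) 1%:M rs)).
  elim: rs {hrs} => [|r rs /= ->] //=.
  by apply: funext => t; rewrite actM.
by rewrite hrs; apply: funext => t; rewrite /act big1 // => s _; rewrite mxE scale0r.
Qed.

(** The order of [C] is partial, but positive elements are real and hence comparable. *)
Lemma pos_lower_bound2 (x y : C) : 0 < x -> 0 < y ->
  exists z, [/\ 0 < z, z <= x & z <= y].
Proof.
move=> x0 y0; have [xy|/ltW yx] := real_leP (gtr0_real x0) (gtr0_real y0).
  by exists x.
by exists y.
Qed.

Lemma pos_lower_bound (I : finType) (f : I -> C) : (forall i, 0 < f i) ->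
  exists2 z, 0 < z & forall i, z <= f i.
Proof.
move=> f0; suff [z z0 hz] : exists2 z, 0 < z & forall i, i \in enum I -> z <= f i.
  by exists z => // i; apply: hz; rewrite mem_enum.
elim: (enum I) => [|i s [z z0 hz]]; first by exists 1.
have [u [u0 uf uz]] := pos_lower_bound2 (f0 i) z0.
exists u => // j; rewrite inE => /orP[/eqP -> //|js].
exact: le_trans uz (hz j js).
Qed.

Lemma roots_gap (rs : seq C) :
  exists2 g, 0 < g & forall r, r \in rs -> r != 0 -> g <= `|r|.
Proof.
elim: rs => [|r rs [g g0 hg]]; first by exists 1.
have [->|r0] := eqVneq r 0.
  by exists g => // s; rewrite inE => /orP[/eqP ->|/hg //]; rewrite eqxx.
have [u [u0 ur ug]] := pos_lower_bound2 (x := `|r|) (y := g) ltac:(by rewrite normr_gt0) g0.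
exists u => // s; rewrite inE => /orP[/eqP -> //|srs s0].
exact: le_trans ug (hg s srs s0).
Qed.

(** A row [v] in the kernel satisfies [v B = - r v]; comparing the sums of the absolute values of
    the entries gives [|r| <= m e]. *)
Lemma small_shift_unitmx m (B : 'M[C]_m) (r e : C) : r != 0 ->
  (forall i j, `|B i j| <= e) -> m%:R * e < `|r| -> B + r%:M \in unitmx.
Proof.
move=> r0 hB hr; rewrite unitmxE unitfE; apply/negP => /det0P[v v0].
rewrite mulmxDr mul_mx_scalar => /eqP; rewrite addr_eq0 => /eqP vB.
pose S := \sum_j `|v 0 j|.
have S0 : 0 < S.
  have S_ge0 : 0 <= S by apply: sumr_ge0.
  rewrite lt_neqAle S_ge0 andbT eq_sym; apply: contra v0 => /eqP Seq.
  apply/eqP/rowP => j; rewrite mxE; apply/eqP; rewrite -normr_eq0.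
  have /psumr_eq0P := Seq; move=> -> //.
have : `|r| * S <= m%:R * e * S.
  rewrite mulr_sumr.
  have -> : \sum_j `|r| * `|v 0 j| = \sum_j `|(v *m B) 0 j|.
    by apply: eq_bigr => j _; rewrite vB !mxE normrN normrM.
  apply: (@le_trans _ _ (\sum_(j < m) \sum_i `|v 0 i| * e)).
    apply: ler_sum => j _; rewrite mxE; apply: le_trans (ler_norm_sum _ _ _) _.
    by apply: ler_sum => i _; rewrite normrM ler_wpM2l.
  rewrite sumr_const card_ord -mulr_suml -/S -[X in X <= _]mulr_natl.
  by rewrite -mulrA [e * S]mulrC.
by rewrite ler_pM2r // => /le_lt_trans/(_ hr); rewrite ltxx.
Qed.

Lemma comm_invmx m (M U : 'M[C]_m) : U \in unitmx -> M * U = U * M ->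
  M * invmx U = invmx U * M.
Proof.
move=> hU comm; have VU : invmx U * U = 1 by exact: mulVmx.
have UV : U * invmx U = 1 by exact: mulmxV.
by rewrite -[LHS]mul1r -VU -mulrA [U * _]mulrA -comm -mulrA UV mulr1.
Qed.

(* The Fitting decomposition of [N], in the form: the decreasing sequence of
   the images of [N^t] is stationary. *)
Lemma fitting m (N : 'M[C]_m) : exists t, forall s,
  exists2 M, M * N = N * M & N ^+ t = N ^+ s * M * N ^+ t.
Proof.
have [rs hrs] := mx_annihilating_roots N.
have Zl k (A B : 'M[C]_m) : (k *: A) * B = k *: (A * B) := esym (scalemxAl k A B).
have Zr k (A B : 'M[C]_m) : A * (k *: B) = k *: (A * B) := esym (scalemxAr k A B).
(* The nonzero roots of the annihilating product are collected in [k (1 - N M)], the zero roots in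
   [N ^+ t]. *)
have [k [t [M [k0 comm E]]]] : exists k t M, [/\ k != 0, M * N = N * M &
    foldr (fun r M => (N - r%:M) *m M) 1%:M rs = k *: ((1 - N * M) * N ^+ t)].
  elim: rs {hrs} => [|r rs [k [t [M [k0 comm]]]]] /=.
    exists 1, 0%N, 0; rewrite oner_eq0 mul0r mulr0 subr0 expr0 mulr1 scale1r.
    by split.
  move=> ->; have [->|r0] := eqVneq r 0.
    exists k, t.+1, M; split=> //; rewrite raddf0 subr0 -scalemxAr exprS.
    congr (_ *: _); rewrite -[LHS]/(N * _) !mulrA; congr (_ * _).
    by rewrite mulrBl mulrBr mul1r mulr1 -!mulrA comm.
  (* With [M'] for the new witness, [(N - r) (1 - N M) = - r (1 - N M')]. *)
  exists (- r * k), t, (M + r^-1 *: (1 - N * M)).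
  have comm' : GRing.comm N (M + r^-1 *: (1 - N * M)).
    apply: commrD; first exact: esym.
    rewrite /GRing.comm Zl Zr; congr (_ *: _).
    apply: commrB; first exact: commr1.
    by apply: commrM => //; apply/esym.
  split; [by rewrite mulf_neq0 ?oppr_eq0|by []|].
  rewrite -scalemxAr mulrC -scalerA; congr (_ *: _).
  rewrite -[LHS]/((N - r%:M) * _) mulrA -Zl; congr (_ * _).
  set P := 1 - N * M; rewrite mulrBl [N * (_ + _)]mulrDr Zr opprD addrA -/P.
  rewrite scalerBr !scaleNr opprK scalerA mulfV // scale1r addrC.
  by rewrite -[r%:M * _]/(r%:M *m _) mul_scalar_mx.
exists t; have E1 : N ^+ t = N * M * N ^+ t.
  apply/eqP; rewrite -subr_eq0 -[X in X - _]mul1r -mulrBl.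
  by move: hrs; rewrite E => /eqP; rewrite scaler_eq0 (negPf k0).
move=> s; exists (M ^+ s); first exact/commr_sym/commrX/esym.
elim: s => [|s IH]; first by rewrite !expr0 !mul1r.
have cX : M ^+ s * N = N * M ^+ s by apply/commr_sym/commrX/esym.
rewrite {1}IH {1}E1 [N ^+ s.+1]exprSr [M ^+ s.+1]exprSr !mulrA.
by congr (_ * _ * _); rewrite -!mulrA cX.
Qed.

End Spectral.

(** * Vanishing and non-vanishing of twisted cohomology *)

Section Cohomology.
Variables (C : numClosedFieldType) (n : nat) (c : 'I_n -> 'I_n -> 'I_n -> C).
Hypothesis hL : is_lie c.
Variables (m : nat).
Local Notation cochain := (Defs.form n).
Local Notation vcochain := (Defs.form n 'cV[C]_m).

Definition lie_der_prod x (rs : seq C) k (a : vcochain k) : vcochain k :=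
  foldr (fun r b => lie_der c x b - r *: b) a rs.

(** The indicators of all tuples, alternating or not, give [L_x] a scalar matrix. The roots depend
    on neither [eta] nor [N], so that one radius can serve all small connections. *)
Lemma lie_der_roots x k : exists rs : seq C,
  forall a : vcochain k, lie_der_prod x rs a = 0.
Proof.
pose T := {ffun 'I_k -> 'I_n}.
pose delta (s : T) : cochain C^o k := fun y => (finfun y == s)%:R.
have expand (a : vcochain k) y :
    lie_der c x a y = \sum_(s : T) (lie_der c x (delta s) y : C) *: a s.
  have aE z : a z = \sum_(s : T) (delta s z : C) *: a s.
    rewrite (bigD1 (finfun z)) //= /delta eqxx scale1r big1 ?addr0.
      by congr (a _); apply: funext => i; rewrite ffunE.
    by move=> s neq; rewrite eq_sym (negPf neq) scale0r.
  rewrite /lie_der; under [RHS]eq_bigr => s _ do rewrite scaler_suml.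
  rewrite [RHS]exchange_big; apply: eq_bigr => l _ /=.
  under [RHS]eq_bigr => s _ do rewrite scaler_suml.
  rewrite [RHS]exchange_big; apply: eq_bigr => b _ /=.
  by rewrite aE scaler_sumr; apply: eq_bigr => s _; rewrite scalerA.
have [rs hrs] := annihilating_roots (fun t s : T => (lie_der c x (delta s) t : C)).
exists rs => a; apply: funext => y.
have -> : y = (finfun y : T) by apply: funext => i; rewrite ffunE.
apply: etrans (congr1 (@^~ (finfun y)) (hrs _ (fun t : T => a t))).
elim: rs {hrs} (finfun y) => [|r rs IH] //= t.
rewrite -[LHS]/(lie_der c x (lie_der_prod x rs a) t - r *: lie_der_prod x rs a t).
by rewrite IH expand; congr (_ - _); apply: eq_bigr => s _; rewrite IH.
Qed.

Section Twist.
Variable eta : 'I_n -> C.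
Hypothesis eta_closed : forall x y, \sum_b c x y b * eta b = 0.
Local Notation twd := (twd c eta).

Definition bounds N p (a : vcochain p.+1) := exists2 b, alt b & twd N b = a.

(* By Cartan's formula [L_x] acts on the cohomology of [twd N] as [- eta x *: N],
   and a product of the [L_x - r] vanishes. *)
Lemma bounds_expN N x p (rs : seq C) :
  (forall a : vcochain p.+1, lie_der_prod x rs a = 0) -> eta x != 0 ->
  (forall r, r \in rs -> r != 0 -> eta x *: N + r%:M \in unitmx) ->
  exists s, forall a : vcochain p.+1, alt a -> twd N a = 0 ->
    bounds N (mulf (N ^+ s) a).
Proof.
move=> hrs etax hU.
have Zl k (A B : 'M[C]_m) : (k *: A) * B = k *: (A * B) := esym (scalemxAl k A B).
have Zr k (A B : 'M[C]_m) : A * (k *: B) = k *: (A * B) := esym (scalemxAr k A B).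
(* On a cocycle, [L_x - r] agrees with [- U r] up to a boundary. *)
pose U r : 'M[C]_m := eta x *: N + r%:M.
have commU r M : M * N = N * M -> M * U r = U r * M.
  move=> comm; rewrite mulrDr mulrDl Zl Zr comm; congr (_ + _).
  exact: scalar_mxC.
pose P := foldr (fun r M => - U r * M) 1.
have commP l : P l * N = N * P l.
  elim: l => [|r l IH] /=; first by rewrite mulr1 mul1r.
  by rewrite !mulNr mulrN -mulrA IH !mulrA (commU r N).
have step l (a : vcochain p.+1) : alt a -> twd N a = 0 ->
    exists2 b, alt b & lie_der_prod x l a = mulf (P l) a + twd N b.
  move=> hA dA; elim: l => [|r l [b hb IH]].
    exists 0; first exact: alt0.
    by rewrite twd_0 addr0 [mulf _ _]mulf1.
  (* The contraction bounds [(L_x + eta(x) N) (P l) a] by Cartan's formula; the rest is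
     [(L_x - r) b]. *)
  exists (ctr x (mulf (P l) a) + lie_der c x b - r *: b).
    apply: altB; last exact: altZ.
    apply: altD; last exact: alt_lie_der.
    exact/altS/alt_mulf.
  rewrite /= -/(lie_der_prod x l a) IH.
  have := ctr_twd c eta N x (alt_mulf (P l) hA).
  rewrite twd_mulf; last exact: commP.
  rewrite dA => /esym; rewrite mulf_0 ctr_0.
  move/eqP; rewrite subr_eq0 => /eqP E.
  rewrite !twd_lin -E lie_der_lin (lie_der_twd hL eta_closed) //.
  have -> : mulf (- U r * P l) a
      = - (eta x *: mulf N (mulf (P l) a)) - r *: mulf (P l) a.
    apply: funext => y; rewrite -[LHS]/((- U r *m P l) *m a y) mulNmx mulmxDl.
    rewrite -scalemxAl mul_scalar_mx opprD mulmxDl !mulNmx -!scalemxAl.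
    by rewrite -mulmxA.
  have regroup (V : zmodType) (X Y Z T W : V) :
      X + Y + (- Z - T) = - W - Z + (X + W + Y - T).
    by rewrite !addrA [RHS](ACl ((1*4)*3*5*2*6)) /= addNr add0r.
  by rewrite scalerDr opprD; apply: regroup.
(* [M'] inverts the factors with [r != 0]; each factor with [r = 0] is [- eta x *: N] and
   contributes one power of [N]. *)
have [M' [s [commM' E]]] : exists (M' : 'M[C]_m) (s : nat),
    M' * N = N * M' /\ M' * P rs = N ^+ s.
  have : {subset rs <= rs} by [].
  elim: {1 3}rs => [|r l IH] sub.
    by exists 1, 0%N; split; [rewrite mulr1 mul1r|rewrite mul1r expr0].
  have [|M' [s [commM' E]]] := IH.
    by move=> r' hr'; apply: sub; rewrite inE hr' orbT.
  rewrite -[P (r :: l)]/(- U r * P l); have [r0|r0] := eqVneq r 0.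
    exists (- (eta x)^-1 *: M'), s.+1; split; first by rewrite Zl Zr commM'.
    rewrite /U r0 raddf0 addr0 Zl mulNr mulrN mulrA Zr Zl scaleNr scalerN opprK.
    by rewrite scalerA mulVf // scale1r commM' -mulrA E exprS.
  have Ur := hU r (sub r (mem_head r l)) r0.
  have commV : M' * invmx (U r) = invmx (U r) * M'.
    exact/comm_invmx/commU.
  have commN : N * invmx (U r) = invmx (U r) * N.
    exact/comm_invmx/commU.
  exists (- (M' * invmx (U r))), s; split.
    by rewrite mulNr mulrN -mulrA -commN !mulrA commM'.
  rewrite !mulNr mulrN opprK -E -mulrA; congr (_ * _).
  have VU : invmx (U r) * U r = 1 := mulVmx Ur.
  by rewrite mulrA VU mul1r.
exists s => a hA dA; have [b hb hab] := step rs a hA dA.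
exists (mulf M' (- b)); first exact/alt_mulf/altN.
rewrite twd_mulf // twd_lin -E -[M' * _]/(M' *m _) -mulfM; congr (mulf _ _).
by apply/eqP; rewrite eq_sym -subr_eq0 opprK -hab hrs.
Qed.

End Twist.
End Cohomology.

(** * Comparison of twisted with untwisted cohomology *)

Section Resonance.
Variables (C : numClosedFieldType) (n : nat) (c : 'I_n -> 'I_n -> 'I_n -> C).
Hypothesis hL : is_lie c.
Variable m : nat.
Local Notation cochain := (Defs.form n).
Local Notation vcochain := (Defs.form n 'cV[C]_m).

Definition rowf (u : 'rV[C]_m) (v : 'cV[C]_m) : C^o := (u *m v) 0 0.
Definition colf (v : 'cV[C]_m) (t : C^o) : 'cV[C]_m := (t : C) *: v.

Lemma rowf_is_linear u : linear (rowf u).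
Proof. by move=> t v w; rewrite /rowf mulmxDr -scalemxAr !mxE. Qed.
HB.instance Definition _ u :=
  GRing.isLinear.Build C 'cV[C]_m C^o *:%R (rowf u) (rowf_is_linear u).

Lemma colf_is_linear v : linear (colf v).
Proof. by move=> t a b; rewrite /colf scalerDl scalerA. Qed.
HB.instance Definition _ v :=
  GRing.isLinear.Build C C^o 'cV[C]_m *:%R (colf v) (colf_is_linear v).

Lemma cochain_entries k (a : vcochain k) : a =
  \sum_(j < m) fpost (colf (delta_mx j 0)) (fpost (rowf (delta_mx 0 j)) a).
Proof.
apply: funext => y; rewrite fct_sumE; apply/colP => i; rewrite summxE (bigD1 i) //=.
rewrite big1 ?addr0 => [|j neq].
  by rewrite /fpost /colf /rowf -rowE !mxE !eqxx mulr1.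
by rewrite /fpost /colf !mxE eq_sym (negPf neq) mulr0.
Qed.

(** The untwisted differential acts on each coordinate of [V] separately, so primitives are found
    coordinatewise. *)
Lemma exact_vcochain p : ~ Hh_nz c p.+1 -> forall a : vcochain p.+1,
  alt a -> ce_d c a = 0 -> exists2 b, alt b & ce_d c b = a.
Proof.
move=> hH a hA da.
have hb (j : 'I_m) : exists b : cochain C^o p,
    alt b /\ ce_d c b = fpost (rowf (delta_mx 0 j)) a.
  apply: contrapT => hb; apply: hH; exists (fpost (rowf (delta_mx 0 j)) a).
  split; first exact/alternatingP/alt_post.
  split=> [x|[b [hB db]]]; first by rewrite ce_d_post da; exact: linear0.
  by apply: hb; exists b; split; [exact/alternatingP|exact: funext].
have [b hB] := fin_all_exists hb.
exists (\sum_j fpost (colf (delta_mx j 0)) (b j)).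
  by apply: alt_sum => j; apply/alt_post/(hB j).1.
rewrite [RHS]cochain_entries linear_sum; apply: eq_bigr => j _.
by rewrite -(hB j).2 -ce_d_post.
Qed.

Section Twist.
Variable eta : 'I_n -> C.
Hypothesis eta_closed : forall x y, \sum_b c x y b * eta b = 0.
Local Notation twd := (twd c eta).

(* Modulo [N ^+ k.+1] the twisted differential of an [N ^+ k]-valued cochain is
   the untwisted one. *)
Lemma cocycle_filtration N p : ~ Hh_nz c p.+1 -> forall k (a : vcochain p.+1),
  alt a -> twd N a = 0 ->
  exists e a', [/\ alt e, alt a' & a = twd N e + mulf (N ^+ k) a'].
Proof.
move=> hH; elim=> [|k IH] a hA da.
  exists 0, a; split=> //; first exact: alt0.
  by rewrite twd_0 add0r expr0 [RHS]mulf1.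
have [e [a' [hE hA' E]]] := IH a hA da.
have dz : twd N (mulf (N ^+ k) a') = 0.
  by have := da; rewrite {1}E twd_lin twd_twd // add0r.
(* [P * Q'] is a projection onto the image of [P]; [R] below is [N ^+ k] followed by the
   complementary projection. *)
pose P := N ^+ k.+1; pose Q' := pinvmx P; pose Q := pinvmx (N ^+ k).
have PQP : P * Q' * P = P by exact/mulmxKpV.
have NQN : N ^+ k * Q * N ^+ k = N ^+ k by exact/mulmxKpV.
pose R := (1 - P * Q') * N ^+ k.
(* The cocycle condition reads [d (N^k a') = - eta /\ N^(k+1) a'], and [1 - P * Q'] kills the right
   side. *)
have dR : ce_d c (mulf R a') = 0.
  move/eqP: dz; rewrite /twd addr_eq0 => /eqP dz.
  have -> : mulf R a' = mulf (1 - P * Q') (mulf (N ^+ k) a') by rewrite mulfM.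
  rewrite ce_d_mulf dz mulf_lin wedge1_mulf mulfM wedge1_mulf mulfM.
  rewrite -[_ *m _ *m _]/((1 - P * Q') * N * N ^+ k) -mulrA -exprS mulrBl mul1r PQP subrr.
  by apply: funext => y; rewrite -[LHS]/(- (0 *m _)) mul0mx oppr0.
have [e1 hE1 de1] := exact_vcochain hH (alt_mulf R hA') dR.
(* [R] has its values in the image of [N ^+ k], so [e1] may be replaced by a primitive with values
   there, whose twist falls in the image of [N ^+ k.+1]. *)
have E1 : mulf (N ^+ k * Q) (mulf R a') = mulf R a'.
  rewrite mulfM -[_ *m R]/(N ^+ k * Q * R); congr (mulf _ a').
  have -> : R = N ^+ k * (1 - N * Q' * N ^+ k).
    by rewrite /R /P exprSr mulrBl mul1r mulrBr mulr1 !mulrA.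
  by rewrite mulrA NQN.
exists (e + mulf (N ^+ k * Q) e1).
exists (mulf (Q' * N ^+ k) a' - mulf Q (wedge1 eta e1)).
split.
- by apply: altD => //; exact: alt_mulf.
- by apply: altB; apply: alt_mulf => //; exact: alt_wedge1.
have E2 : twd N (mulf (N ^+ k * Q) e1) = mulf R a' + mulf P (mulf Q (wedge1 eta e1)).
  rewrite /twd ce_d_mulf de1 E1 !mulfM wedge1_mulf; congr (_ + mulf _ _).
  by rewrite -[RHS]/(P * Q) /P exprS -mulrA.
have E3 : mulf (N ^+ k) a' = mulf R a' + mulf P (mulf (Q' * N ^+ k) a').
  apply: funext => y; rewrite -[RHS]/(R *m _ + P *m (_ *m _)) mulmxA -mulmxDl.
  congr (_ *m _); rewrite -[P *m _]/(P * (Q' * N ^+ k)) /R mulrBl mul1r.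
  by rewrite -(mulrA P Q') subrK.
rewrite twd_lin mulf_lin mulf_lin -addrA E2 [in LHS]E E3; congr (_ + _).
by rewrite -[RHS]addrA; congr (_ + _); rewrite [RHS]addrC subrK.
Qed.

(** The filtration leaves a cocycle with values in the image of [N ^+ t]; there the Fitting
    decomposition extracts a factor [N ^+ s], which maps cocycles to boundaries. *)
Lemma twd_acyclic N p x (rs : seq C) : ~ Hh_nz c p.+1 ->
  (forall a : vcochain p.+1, lie_der_prod c x rs a = 0) -> eta x != 0 ->
  (forall r, r \in rs -> r != 0 -> eta x *: N + r%:M \in unitmx) ->
  ~ Hnz (fun k (a : vcochain k) => twd N a) p.+1.
Proof.
move=> hH hrs etax hU [a [/alternatingP hA [da]]]; apply.
have {}da : twd N a = 0 by apply: funext.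
have [s hs] := bounds_expN hL eta_closed hrs etax hU.
have [t /(_ s)[M commM Ft]] := fitting N.
have [e [a' [hE hA' E]]] := cocycle_filtration hH t hA da.
pose z := mulf (N ^+ t) a'.
have hZ : alt z by exact: alt_mulf.
have dz : twd N z = 0.
  by have := da; rewrite {1}E twd_lin twd_twd // add0r.
have [b hB db] : bounds c eta N (mulf (N ^+ s) (mulf M z)).
  by apply: hs; [exact: alt_mulf|rewrite twd_mulf // dz mulf_0].
exists (e + b); split; first exact/alternatingP/altD.
move=> y; rewrite twd_lin db [in RHS]E; congr ((_ + _) y).
by rewrite /z !mulfM [in RHS]Ft.
Qed.

(** Covers [eta = 0], where no [x] with [eta x != 0] is available; for [N = 0] one step of the
    filtration suffices. *)
Lemma twd0_acyclic p : ~ Hh_nz c p.+1 -> ~ Hnz (fun k (a : vcochain k) => twd 0 a) p.+1.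
Proof.
move=> hH [a [/alternatingP hA [da]]]; apply.
have {}da : twd 0 a = 0 by apply: funext.
have [e [a' [hE _ E]]] := cocycle_filtration hH 1 hA da.
exists e; split=> [|y]; first exact/alternatingP.
by rewrite [in RHS]E -[RHS]/(_ + 0 *m _) mul0mx addr0.
Qed.

Lemma twd_unit_acyclic0 N x : N \in unitmx -> eta x != 0 ->
  ~ Hnz (fun k (a : vcochain k) => twd N a) 0.
Proof.
move=> NU etax [a [_ [da [y]]]]; apply/negP; rewrite negbK.
have := ctr_twd0 c eta N x a; have -> : twd N a = 0 by apply: funext.
rewrite ctr_0 => /(congr1 (fun b : vcochain 0 => invmx N *m b y)).
rewrite -[RHS]/(invmx N *m (_ *: (N *m a y))) -scalemxAr mulKmx // mulmx0.
by move/esym/eqP; rewrite scaler_eq0 (negPf etax).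
Qed.

(** A power of [N] maps cocycles to boundaries, and its inverse commutes with the differential. *)
Lemma twd_unit_acyclic N p x (rs : seq C) : N \in unitmx ->
  (forall a : vcochain p.+1, lie_der_prod c x rs a = 0) -> eta x != 0 ->
  (forall r, r \in rs -> r != 0 -> eta x *: N + r%:M \in unitmx) ->
  ~ Hnz (fun k (a : vcochain k) => twd N a) p.+1.
Proof.
move=> NU hrs etax hU [a [/alternatingP hA [da]]]; apply.
have {}da : twd N a = 0 by apply: funext.
have [s hs] := bounds_expN hL eta_closed hrs etax hU.
have [b hB db] := hs a hA da.
have NsU : N ^+ s \in unitmx.
  by elim: s {hs db} => [|s IH]; rewrite ?expr0 ?unitmx1 // exprS unitmx_mul NU.
exists (mulf (invmx (N ^+ s)) b); split=> [|y].
  exact/alternatingP/alt_mulf.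
rewrite twd_mulf ?db ?mulfM ?mulVmx ?mulf1 //.
by apply/esym/comm_invmx => //; exact: commrX.
Qed.

(* If [a (x) v] with [N *m v = 0] is a boundary then [eta /\ a = - d (eta /\ b)]
   for some [b], and [a (x) u + (eta /\ b) (x) N u] is a cocycle for every [u];
   it is not a boundary if [phi u = 1] for some [phi] with [phi *m N = 0]. *)
Lemma twd_singular N i : \det N = 0 -> Hh_nz c i ->
  Hnz (fun k (a : vcochain k) => twd N a) i.
Proof.
move=> dN; have /det0P[phi phi0 phiN] := introT eqP dN.
have /det0P[w w0 wN] : \det N^T == 0 by rewrite det_tr dN.
have [v v0 Nv] : exists2 v : 'cV_m, v != 0 & N *m v = 0.
  by exists w^T; rewrite ?trmx_eq0 // -[N]trmxK -trmx_mul wN trmx0.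
have [j vj] : exists j, v j 0 != 0.
  apply: contrapT => hv; case/eqP: v0; apply/colP => j; rewrite [RHS]mxE.
  by apply/eqP; apply: contrapT => /negP vj; apply: hv; exists j.
have [l phil] : exists l, phi 0 l != 0.
  apply: contrapT => hv; case/eqP: phi0; apply/rowP => l; rewrite [RHS]mxE.
  by apply/eqP; apply: contrapT => /negP pl; apply: hv; exists l.
have mulf_colf k (b : cochain C^o k) z : mulf N (fpost (colf z) b) = fpost (colf (N *m z)) b.
  by apply: funext => y; rewrite -[LHS]/(N *m (_ *: z)) -scalemxAr.
have colf0 k (b : cochain C^o k) : fpost (colf 0) b = 0 :> vcochain k.
  by apply: funext => y; exact: scaler0.
have dv k (a : cochain C^o k) : ce_d c a = 0 -> twd N (fpost (colf v) a) = 0.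
  move=> da; rewrite /twd mulf_colf Nv colf0 ce_d_post da linear0 addr0.
  by apply: funext => y; exact: scale0r.
have dcol k (e : cochain C^o k) z : twd N (fpost (colf z) e)
    = fpost (colf z) (ce_d c e) + fpost (colf (N *m z)) (wedge1 eta e).
  by rewrite /twd mulf_colf ce_d_post wedge1_post.
case=> a [/alternatingP hA [da]].
have {}da : ce_d c a = 0 by apply: funext.
case: i a hA da => [|p] a hA da /= hnz.
  exists (fpost (colf v) a); split; first by apply/alternatingP.
  split=> [x|]; first by rewrite dv.
  case: hnz => y ay; exists y; apply: contra vj => /eqP /colP /(_ j).
  by rewrite !mxE => /eqP; rewrite mulf_eq0 (negPf ay).
apply: contrapT => hN; have bdry (a' : vcochain p.+1) : alt a' -> twd N a' = 0 ->
    exists2 b, alt b & twd N b = a'.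
  move=> hA' da'; apply: contrapT => hb; apply: hN; exists a'.
  split; first exact/alternatingP.
  split=> [x|[b [/alternatingP hB db]]]; first by rewrite da'.
  by apply: hb; exists b => //; apply: funext.
have [b hB db] := bdry _ (alt_post (colf v) hA) (dv _ _ da).
pose psi : 'rV[C]_m := (v j 0)^-1 *: delta_mx 0 j.
pose beta := fpost (rowf psi) b.
have psiv : psi *m v = 1%:M.
  rewrite /psi -scalemxAl -rowE; apply/matrixP => i1 i2.
  by rewrite !ord1 !mxE mulVf.
have rowf_colf k (e : cochain C^o k) (f : 'rV[C]_m) z :
    fpost (rowf f) (fpost (colf z) e) = (f *m z) 0 0 *: e.
  apply: funext => y; rewrite -[LHS]/((f *m (_ *: z)) 0 0) -scalemxAr mxE.
  exact: mulrC.
have rowf_mulf k (e : vcochain k) (f : 'rV[C]_m) :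
    fpost (rowf f) (mulf N e) = fpost (rowf (f *m N)) e.
  by apply: funext => y; rewrite -[RHS]/((f *m N *m _) 0 0) -mulmxA.
have rowfD k (e1 e2 : vcochain k) f :
    fpost (rowf f) (e1 + e2) = fpost (rowf f) e1 + fpost (rowf f) e2.
  by apply: funext => y; exact: linearD.
have rowf_twd k (e : vcochain k) f : fpost (rowf f) (twd N e)
    = ce_d c (fpost (rowf f) e) + wedge1 eta (fpost (rowf (f *m N)) e).
  by rewrite /twd rowfD ce_d_post -rowf_mulf [in RHS]wedge1_post.
(* Applying [psi] to [twd N b] gives [a = d beta + eta /\ (psi N b)]; the wedge with [eta] removes
   the last term. *)
have ea : wedge1 eta a = - ce_d c (wedge1 eta beta).
  have := congr1 (fun e : vcochain p.+1 => fpost (rowf psi) e) db.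
  rewrite rowf_colf psiv mxE eqxx scale1r rowf_twd => <-.
  rewrite wedge1_lin wedge1_wedge1 addr0 ce_d_wedge1 ?opprK //.
  exact: alt_post.
pose u : 'cV[C]_m := (phi 0 l)^-1 *: delta_mx l 0.
have phiu : phi *m u = 1%:M.
  rewrite /u -scalemxAr -colE; apply/matrixP => i1 i2.
  by rewrite !ord1 !mxE mulVf.
have hbeta : alt (wedge1 eta beta) by exact/alt_wedge1/alt_post.
have [] := bdry (fpost (colf u) a + fpost (colf (N *m u)) (wedge1 eta beta)).
- by apply: altD; apply: alt_post.
- rewrite twd_lin !dcol da wedge1_wedge1 ea; apply: funext => y.
  rewrite -[LHS]/(colf u 0 + colf _ (- ce_d c (wedge1 eta beta) y)
                  + (colf _ (ce_d c (wedge1 eta beta) y) + colf _ 0)).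
  by rewrite /colf scaleNr !scale0r add0r addr0 addNr.
(* Since [phi N = 0], applying [phi] removes both the twist and the correction term, and leaves
   [a = d (phi b')]. *)
- move=> b' hB' /(congr1 (fun e : vcochain p.+1 => fpost (rowf phi) e)).
  rewrite rowf_twd phiN rowfD !rowf_colf phiu mulmxA phiN mul0mx.
  rewrite mxE eqxx scale1r [in (_ : 'M_1) _ _]mxE scale0r addr0.
  have -> : fpost (rowf 0) b' = 0.
    by apply: funext => y; rewrite -[LHS]/((0 *m _) 0 0) mul0mx mxE.
  move=> db'; apply: hnz; exists (fpost (rowf phi) b'); split.
    exact/alternatingP/alt_post.
  by move=> x; rewrite -db' linear0 addr0.
Qed.

End Twist.
End Resonance.

(** * Flat connections near zero *)

Section Sl2.
Variable C : numClosedFieldType.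
Implicit Types X Y : 'M[C]_2.

Lemma mulmx2E X Y i j : (X *m Y) i j = X i 0 * Y 0 j + X i 1 * Y 1 j.
Proof.
rewrite mxE !big_ord_recl big_ord0 addr0; congr (_ * _ + X i _ * Y _ j);
  exact: val_inj.
Qed.

Lemma mx2P X Y : X 0 0 = Y 0 0 -> X 0 1 = Y 0 1 -> X 1 0 = Y 1 0 ->
  X 1 1 = Y 1 1 -> X = Y.
Proof.
move=> h00 h01 h10 h11; apply/matrixP => i j.
have I2 (k : 'I_2) : k = 0 \/ k = 1.
  by case: k => [[|[|//]]] lt; [left|right]; exact: val_inj.
by case: (I2 i) => ->; case: (I2 j) => ->.
Qed.

Lemma det_mx22 X : \det X = X 0 0 * X 1 1 - X 0 1 * X 1 0.
Proof.
rewrite (expand_det_row X 0) !big_ord_recl big_ord0 addr0 /cofactor !det_mx11 !mxE.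
have -> : lift ord0 ord0 = 1 :> 'I_2 by exact: val_inj.
have -> : lift 1 0 = 0 :> 'I_2 by exact: val_inj.
by rewrite /= expr0 expr1 mul1r mulN1r mulrN.
Qed.

Lemma sl2E X : sl2 X <-> X 1 1 = - X 0 0.
Proof.
rewrite /sl2 /mxtrace !big_ord_recl big_ord0 addr0.
have -> : lift ord0 ord0 = 1 :> 'I_2 by exact: val_inj.
rewrite addrC; split=> [/eqP|->]; last by rewrite addNr.
by rewrite addr_eq0 => /eqP.
Qed.

Lemma sl2_11 X : sl2 X -> X 1 1 = - X 0 0.
Proof. by move/sl2E. Qed.

Lemma det_sl2 X : sl2 X -> \det X = - X 0 0 ^+ 2 - X 0 1 * X 1 0.
Proof. by move=> sX; rewrite det_mx22 sl2_11 // mulrN expr2. Qed.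

Lemma sl2DZ s t X Y : sl2 X -> sl2 Y -> sl2 (s *: X + t *: Y).
Proof. by rewrite /sl2 mxtraceD !mxtraceZ => -> ->; rewrite !mulr0 addr0. Qed.

Lemma sl2D X Y : sl2 X -> sl2 Y -> sl2 (X + Y).
Proof. by rewrite /sl2 mxtraceD => -> ->; rewrite addr0. Qed.

(** By Cayley-Hamilton [X^2 = - det X], so the eigenvalues of [ad X] are 0 and the square roots of
    [-4 det X]. *)
Lemma lieb_cube X Y : sl2 X ->
  lieb X (lieb X (lieb X Y)) = (- 4 * \det X) *: lieb X Y.
Proof.
move=> sX; rewrite det_sl2 //; have := sl2_11 sX => h11.
by apply: mx2P; rewrite /lieb !(mulmx2E, mxE) h11; ring.
Qed.

(** [det] is a nondegenerate quadratic form in three variables, whose isotropic subspaces are at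
    most lines; so [X] and [Y] are proportional. *)
Lemma lieb_isotropic X Y : sl2 X -> sl2 Y ->
  \det X = 0 -> \det Y = 0 -> \det (X + Y) = 0 -> lieb X Y = 0.
Proof.
move=> sX sY; rewrite !det_sl2 //; last exact: sl2D.
have hX := sl2_11 sX; have hY := sl2_11 sY; rewrite !mxE.
set p := X 0 0; set q := X 0 1; set r := X 1 0.
set p' := Y 0 0; set q' := Y 0 1; set r' := Y 1 0.
set D1 := - p ^+ 2 - q * r => d1; set D2 := - p' ^+ 2 - q' * r' => d2 d3.
(* [B] is the polar form of [det]. *)
set B := - 2 * (p * p') - q * r' - q' * r.
have B0 : B = 0.
  rewrite (_ : B = (- (p + p') ^+ 2 - (q + q') * (r + r')) - D1 - D2).
    by rewrite d3 d1 d2 !subr0.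
  by rewrite /B /D1 /D2; ring.
(* Each 2 x 2 minor of the coordinates of [X] and [Y] has its square in the ideal generated by [D1],
   [D2] and [B]. *)
have pq : p * q' - p' * q = 0.
  apply/eqP; rewrite -sqrf_eq0; apply/eqP.
  rewrite (_ : _ ^+ 2 = - D1 * q' ^+ 2 - D2 * q ^+ 2 + B * (q * q')).
    by rewrite d1 d2 B0 oppr0 !mul0r subrr addr0.
  by rewrite /B /D1 /D2; ring.
have pr : p * r' - p' * r = 0.
  apply/eqP; rewrite -sqrf_eq0; apply/eqP.
  rewrite (_ : _ ^+ 2 = - D1 * r' ^+ 2 - D2 * r ^+ 2 + B * (r * r')).
    by rewrite d1 d2 B0 oppr0 !mul0r subrr addr0.
  by rewrite /B /D1 /D2; ring.
have qr : q * r' - q' * r = 0.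
  apply/eqP; rewrite -sqrf_eq0; apply/eqP.
  rewrite (_ : _ ^+ 2 = B * (B + 4 * (p * p')) - 4 * D1 * (D2 + p' ^+ 2)
                        - 4 * D2 * p ^+ 2).
    by rewrite d1 d2 B0 mulr0 !mul0r !subr0.
  by rewrite /B /D1 /D2; ring.
apply: mx2P; rewrite /lieb !(mulmx2E, mxE) ?hX ?hY -/p -/q -/r -/p' -/q' -/r'.
- by rewrite -[RHS]qr; ring.
- by rewrite -[RHS](mulr0 2) -pq; ring.
- by rewrite -[RHS](mulr0 (- 2)) -pr; ring.
- by rewrite -[RHS]oppr0 -qr; ring.
Qed.

(** The entries of the bracket are, up to nonzero factors, the minors of the coordinates of [X] and
    [Y]; the ratio [t] is read off at a nonzero entry of [X]. *)
Lemma lieb_commute X Y : sl2 X -> sl2 Y -> X != 0 -> lieb X Y = 0 ->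
  exists t, Y = t *: X.
Proof.
move=> sX sY X0 XY; have hX := sl2_11 sX; have hY := sl2_11 sY.
have two0 : 2 != 0 :> C by rewrite pnatr_eq0.
have pq : X 0 0 * Y 0 1 = Y 0 0 * X 0 1.
  apply/(mulfI two0)/eqP; rewrite -subr_eq0; apply/eqP.
  have /matrixP/(_ 0 1) := XY; rewrite /lieb !(mulmx2E, mxE) ?hX ?hY => <-; ring.
have pr : X 0 0 * Y 1 0 = Y 0 0 * X 1 0.
  apply/(mulfI two0)/eqP; rewrite -subr_eq0 -oppr_eq0; apply/eqP.
  have /matrixP/(_ 1 0) := XY; rewrite /lieb !(mulmx2E, mxE) ?hX ?hY => <-; ring.
have qr : X 0 1 * Y 1 0 = Y 0 1 * X 1 0.
  apply/eqP; rewrite -subr_eq0; apply/eqP.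
  have /matrixP/(_ 0 0) := XY; rewrite /lieb !(mulmx2E, mxE) ?hX ?hY => <-; ring.
have [p0|p0] := eqVneq (X 0 0) 0; last first.
  exists (Y 0 0 / X 0 0); apply: mx2P; rewrite !mxE ?hX ?hY.
  - by rewrite divfK.
  - by rewrite mulrAC -pq mulrAC mulfV // mul1r.
  - by rewrite mulrAC -pr mulrAC mulfV // mul1r.
  - by rewrite mulrN divfK.
have [q0|q0] := eqVneq (X 0 1) 0; last first.
  exists (Y 0 1 / X 0 1); apply: mx2P; rewrite !mxE ?hX ?hY.
  - by apply: (mulIf q0); rewrite -pq p0 mulr0 !mul0r.
  - by rewrite divfK.
  - by rewrite mulrAC -qr mulrAC mulfV // mul1r.
  - rewrite p0 oppr0 mulr0; apply: (mulIf q0).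
    by rewrite mulNr -pq p0 !mul0r oppr0.
have r0 : X 1 0 != 0.
  apply: contraNneq X0 => r0; apply/eqP/mx2P; rewrite mxE ?hX //.
  by rewrite p0 oppr0.
have p'0 : Y 0 0 = 0 by apply: (mulIf r0); rewrite -pr p0 !mul0r.
exists (Y 1 0 / X 1 0); apply: mx2P; rewrite !mxE ?hX ?hY.
- by rewrite p0 mulr0.
- by rewrite q0 mulr0; apply: (mulIf r0); rewrite -qr q0 !mul0r.
- by rewrite divfK.
- by rewrite p0 p'0 oppr0 mulr0.
Qed.

Lemma lieb_suml (I : finType) (f : I -> C) (F : I -> 'M[C]_2) X :
  lieb X (\sum_i f i *: F i) = \sum_i f i *: lieb X (F i).
Proof.
rewrite /lieb mulmx_sumr mulmx_suml -sumrB; apply: eq_bigr => i _.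
by rewrite -scalemxAr -scalemxAl scalerBr.
Qed.

Lemma eigenvalue_root K (A : 'M[C]_K) (u : 'cV[C]_K) mu rs : u != 0 ->
  A *m u = mu *: u -> foldr (fun r M => (A - r%:M) *m M) 1%:M rs = 0 -> mu \in rs.
Proof.
move=> u0 Au hrs.
have : (\prod_(r <- rs) (mu - r)) *: u = 0.
  rewrite -(mul0mx _ u) -hrs.
  elim: rs {hrs} => [|r rs IH] /=; first by rewrite big_nil scale1r mul1mx.
  rewrite big_cons -mulmxA -IH -scalemxAr mulmxBl Au mul_scalar_mx -scalerBl.
  by rewrite scalerA mulrC.
move/eqP; rewrite scaler_eq0 (negPf u0) orbF prodf_seq_eq0 => /hasP[r hr /=].
by rewrite subr_eq0 => /eqP ->.
Qed.
End Sl2.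

(** * Flat connections as Lie homomorphisms *)

Section FlatConnections.
Variables (C : numClosedFieldType) (n : nat) (c : 'I_n -> 'I_n -> 'I_n -> C).

Lemma ce_d_oneform eta (x : 'I_2 -> 'I_n) :
  ce_d c (oneform eta) x = - \sum_b c (x ord0) (x (lift ord0 ord0)) b * eta b.
Proof.
rewrite /ce_d !big_ord_recl big_ord0 addr0.
rewrite [X in _ + X]big_mkcond !big_ord_recl big_ord0 /= !addr0.
rewrite big_mkcond !big_ord_recl big_ord0 /= add0r addr0 -sumrN.
apply: eq_bigr => b _; rewrite expr1 mulN1r /oneform /=.
by rewrite -[LHS]/(- _ * _) mulNr.
Qed.

Lemma closed1P eta :
  closed1 c eta <-> forall x y, \sum_b c x y b * eta b = 0.
Proof.
split=> h x; last by rewrite ce_d_oneform h oppr0.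
move=> y; have := h (icons x (icons y (fun i : 'I_0 => x))).
by rewrite ce_d_oneform iconsS !icons0 => /eqP; rewrite oppr_eq0 => /eqP.
Qed.

(** On basis vectors the two sums of [MC] are [- w([x, y])] and [[w x, w y]]. *)
Lemma MC_lie (w : 'I_n -> 'M[C]_2) : MC c w <-> (forall a, sl2 (w a)) /\
  forall x y, lieb (w x) (w y) = \sum_b c x y b *: w b.
Proof.
have d1 (x : 'I_2 -> 'I_n) : \sum_a (ce_d c (oneform (dual_basis C a)) x : C) *: w a
    = - \sum_b c (x ord0) (x (lift ord0 ord0)) b *: w b.
  rewrite -sumrN; apply: eq_bigr => a _; rewrite ce_d_oneform -scaleNr.
  rewrite (bigD1 a) //= big1 ?addr0 => [|b neq]; last first.
    by rewrite /dual_basis (negPf neq) mulr0.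
  by rewrite /dual_basis eqxx mulr1.
have d2 (x : 'I_2 -> 'I_n) : \sum_(a < n) \sum_(b < n | (a < b)%N)
     (wedge1 (dual_basis C a) (oneform (dual_basis C b)) x : C) *: lieb (w a) (w b)
    = lieb (w (x ord0)) (w (x (lift ord0 ord0))).
  have pick s t : \sum_(a < n) \sum_(b < n | (a < b)%N)
       (dual_basis C a s * dual_basis C b t) *: lieb (w a) (w b)
      = if (s < t)%N then lieb (w s) (w t) else 0.
    rewrite (bigD1 s) //= [X in _ + X]big1 ?addr0 => [|a neq]; last first.
      by rewrite big1 // => b _; rewrite /dual_basis eq_sym (negPf neq) mul0r scale0r.
    rewrite big_mkcond (bigD1 t) //= big1 ?addr0 => [|b neq].
      by rewrite /dual_basis !eqxx mulr1 scale1r.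
    by rewrite /dual_basis [t == b]eq_sym (negPf neq) mulr0 scale0r if_same.
  rewrite (eq_bigr (fun a : 'I_n =>
      \sum_(b < n | (a < b)%N) (dual_basis C a (x ord0)
         * dual_basis C b (x (lift ord0 ord0))) *: lieb (w a) (w b)
      - \sum_(b < n | (a < b)%N) (dual_basis C a (x (lift ord0 ord0))
         * dual_basis C b (x ord0)) *: lieb (w a) (w b))); last first.
    move=> a _; rewrite -sumrB; apply: eq_bigr => b _; rewrite -scalerBl.
    congr (_ *: _); rewrite /wedge1 !big_ord_recl big_ord0 addr0 /oneform /=.
    rewrite expr0 mul1r expr1 mulN1r; congr (_ + _).
    rewrite -[LHS]/(- _ * _) mulNr; congr (- (_ * dual_basis C b (x _))).
    exact: val_inj.
  (* Only one order of the two indices survives the condition [a < b]; antisymmetry of the bracket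
     gives the same value for both. *)
  rewrite sumrB !pick; case: ltngtP => [_|_|/val_inj ->]; rewrite ?subr0 //.
    by rewrite sub0r /lieb opprB.
  by rewrite /lieb subrr.
split=> [[sw h]|[sw h]]; split=> // x.
  move=> y; have := h (icons x (icons y (fun i : 'I_0 => x))).
  rewrite d1 d2 iconsS !icons0 => /eqP; rewrite addrC subr_eq0 => /eqP //.
by rewrite d1 d2 h addNr.
Qed.

Lemma cone_MC (w : 'I_n -> 'M[C]_2) : coneS c w -> MC c w.
Proof.
case=> eta [g [/closed1P etac [sg hw]]]; apply/MC_lie; split=> [a|x y].
  by rewrite /sl2 hw mxtraceZ sg mulr0.
rewrite !hw /lieb -!scalemxAl -!scalemxAr !scalerA [eta y * _]mulrC subrr.
under eq_bigr => b _ do rewrite hw scalerA.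
by rewrite -scaler_suml etac scale0r.
Qed.

(** All values are multiples of one nonzero [w x], and the coefficients vanish on brackets because
    [w] does. *)
Lemma commuting_MC_cone (w : 'I_n -> 'M[C]_2) : MC c w ->
  (forall x y, lieb (w x) (w y) = 0) -> coneS c w.
Proof.
case/MC_lie=> sw hw hcomm.
have [[x wx]|hz] := pselect (exists x, w x != 0); last first.
  exists (fun=> 0), 0; split; first by apply/closed1P => x y; rewrite big1 // => b; rewrite mulr0.
  split; first exact: mxtrace0.
  move=> a; rewrite scaler0; apply/eqP; apply: contrapT => /negP wa.
  by apply: hz; exists a.
have [eta hE] := fin_all_exists (fun b => lieb_commute (sw x) (sw b) wx (hcomm x b)).
exists eta, (w x); split; last by [].
apply/closed1P => y z; have := hw y z; rewrite hcomm.
under eq_bigr => b _ do rewrite hE scalerA.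
by rewrite -scaler_suml => /esym/eqP; rewrite scaler_eq0 (negPf wx) orbF => /eqP.
Qed.

(** The radius depends on [c] alone. Sums [w a + w b] are included so that [det] can be
    polarized. *)
Lemma small_brackets : exists2 e : C, 0 < e & forall w : 'I_n -> 'M[C]_2,
  MC c w -> (forall a i j, `|w a i j| < e) -> forall a b d,
  lieb (w a + w b) (w d) = 0 \/ \det (w a + w b) = 0.
Proof.
(* The rows of [A (a, b)] are the images of the basis under [ad (e_a + e_b)]. *)
pose A (ab : 'I_n * 'I_n) := \matrix_(i, k) (c ab.1 i k + c ab.2 i k).
have [rs hrs] := fin_all_exists (fun ab => mx_annihilating_roots (A ab *m A ab)).
have hg ab : exists g, 0 < g /\ forall r, r \in rs ab -> r != 0 -> g <= `|r|.
  by have [g g0 hg] := roots_gap (rs ab); exists g.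
have [g hg'] := fin_all_exists hg.
have [z z0 hz] := pos_lower_bound (fun ab => (hg' ab).1).
(* The entries of [X] are at most [2 e], so [|4 det X| <= 32 e^2 <= 32 e] for [e <= 1], which is
   below [z] when [e <= z / 64]. *)
have e0 : 0 < z / 64 by rewrite divr_gt0 // ltr0n.
have [e [egt0 ez e1]] := pos_lower_bound2 e0 (@ltr01 C).
exists e => // w /MC_lie[sw hw] we a b d.
have [|D0] := eqVneq (\det (w a + w b)) 0; [by right|left].
apply: contrapT => /eqP/matrix0Pn [i [j Uij]].
set X := w a + w b in D0 Uij; have sX : sl2 X by exact: sl2D.
have act k : lieb X (w k) = \sum_l A (a, b) k l *: w l.
  rewrite /lieb mulmxDl mulmxDr opprD addrACA -!/(lieb _ _) !hw -big_split.
  by apply: eq_bigr => l _; rewrite mxE scalerDl.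
(* By [lieb_cube], one fixed entry of the brackets [[X, w k]] gives an eigenvector of the square of
   [A (a, b)]. *)
pose u : 'cV[C]_n := \col_k lieb X (w k) i j.
have u0 : u != 0.
  by apply: contraNneq Uij => /colP/(_ d); rewrite !mxE => ->.
have Au : A (a, b) *m A (a, b) *m u = (- 4 * \det X) *: u.
  have Av (F : 'I_n -> 'M[C]_2) (v : 'cV[C]_n) : (forall k, v k 0 = F k i j) ->
      forall k, (A (a, b) *m v) k 0 = (\sum_l A (a, b) k l *: F l) i j.
    move=> hv k; rewrite mxE summxE; apply: eq_bigr => l _.
    by rewrite hv [RHS]mxE.
  apply/colP => k; rewrite -mulmxA.
  have A1 l : (A (a, b) *m u) l 0 = lieb X (lieb X (w l)) i j.
    rewrite (Av (fun k => lieb X (w k))); last by move=> k'; rewrite mxE.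
    by rewrite -lieb_suml -act.
  rewrite (Av (fun k => lieb X (lieb X (w k)))) // -!lieb_suml -act.
  by rewrite lieb_cube // !mxE.
have mu0 : - 4 * \det X != 0 by rewrite mulf_neq0 // oppr_eq0 pnatr_eq0.
have := (hg' (a, b)).2 _ (eigenvalue_root u0 Au (hrs (a, b))) mu0.
have X2 k l : `|X k l| <= 2 * e.
  rewrite mxE (le_trans (ler_normD _ _)) // mulr_natl mulr2n.
  by apply: lerD; apply: ltW.
have hmu : `|- 4 * \det X| <= 32 * e.
  rewrite normrM normrN normr_nat det_sl2 //.
  have -> : 32 * e = 4 * (8 * e) by rewrite mulrA -natrM.
  rewrite ler_pM2l ?ltr0n // (le_trans (ler_normB _ _)) // normrN normrX normrM.
  have ee : e * e <= e by rewrite -[X in _ <= X]mulr1 ler_pM2l.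
  have h1 : `|X 0 0| ^+ 2 <= 4 * e.
    apply: (@le_trans _ _ (2 * e * (2 * e))); first by rewrite expr2 ler_pM.
    by rewrite mulrACA -natrM ler_pM2l ?ltr0n.
  have h2 : `|X 0 1| * `|X 1 0| <= 4 * e.
    apply: (@le_trans _ _ (2 * e * (2 * e))); first by rewrite ler_pM.
    by rewrite mulrACA -natrM ler_pM2l ?ltr0n.
  have -> : 8 * e = 4 * e + 4 * e by rewrite -mulrDl -natrD.
  exact: lerD.
move=> /le_trans /(_ hmu); apply/negP.
have : 32 * e < z.
  apply: (@le_lt_trans _ _ (32 * (z / 64))); first by rewrite ler_pM2l ?ltr0n.
  rewrite mulrCA gtr_pMr // ltr_pdivrMr ?ltr0n // mul1r ltr_nat //.
move=> /lt_le_trans /(_ (hz (a, b))) h; apply/negP => /(lt_le_trans h).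
by rewrite ltxx.
Qed.

(** A value with nonzero determinant commutes with all others; two values with determinant 0 either
    commute through their sum or span an isotropic subspace. *)
Lemma MC_germ : is_lie c -> exists2 e : C, 0 < e & forall w : 'I_n -> 'M[C]_2,
  (forall a i j, `|w a i j| < e) -> MC c w <-> coneS c w.
Proof.
move=> hL; have [e e0 he] := small_brackets; exists e => // w we.
split=> [hw|]; last exact: cone_MC.
apply: commuting_MC_cone => // a b; have [sw _] := (MC_lie w).1 hw.
have double x : w x + w x = 2 *: w x by rewrite scaler_nat mulr2n.
have liebZ (t : C) X Y : lieb (t *: X) Y = t *: lieb X Y.
  by rewrite /lieb -scalemxAl -scalemxAr scalerBr.
have two0 : 2 != 0 :> C by rewrite pnatr_eq0.
(* This is [small_brackets] for equal indices, without the factor 2. *)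
have self x y : lieb (w x) (w y) = 0 \/ \det (w x) = 0.
  case: (he w hw we x x y); rewrite double ?liebZ ?detZ => /eqP.
    by rewrite scaler_eq0 (negPf two0) => /eqP; left.
  by rewrite mulf_eq0 expf_eq0 (negPf two0) andbF => /eqP; right.
have anti X Y : lieb X Y = - lieb Y X by rewrite /lieb opprB.
case: (self a b) => // da; case: (self b a) => [|db].
  by move=> ba; rewrite anti ba oppr0.
case: (he w hw we a b b) => [|dab]; last exact: lieb_isotropic.
by rewrite /lieb mulmxDl mulmxDr opprD addrACA subrr addr0.
Qed.
End FlatConnections.

(** * Germs of resonance varieties *)

Section Germs.
Variables (C : numClosedFieldType) (n : nat) (c : 'I_n -> 'I_n -> 'I_n -> C).
Hypothesis hL : is_lie c.
Variables (m : nat) (theta : 'M[C]_2 -> 'M[C]_m).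
Hypothesis hth : sl2_rep theta.

Lemma rep_scale t X : sl2 X -> theta (t *: X) = t *: theta X.
Proof.
move=> sX; have := hth.1 X X t 0 sX sX.
by rewrite !scale0r !addr0.
Qed.

Lemma rep_0 : theta 0 = 0.
Proof. by rewrite -(scale0r (0 : 'M_2)) rep_scale ?scale0r //; exact: mxtrace0. Qed.

Lemma zero_coneSdet (w : 'I_n -> 'M[C]_2) : (0 < m)%N -> set_zero w ->
  coneSdet c theta w.
Proof.
move=> m0 w0; exists (fun=> 0), 0; split.
  by apply/closed1P => x y; rewrite big1 // => b; rewrite mulr0.
split; first exact: mxtrace0.
split=> [|a]; last by rewrite scaler0.
by rewrite rep_0; case: (m) m0 => // k _; rewrite det0.
Qed.

(** [theta X] is linear in the coordinates of [X] in the basis [H], [E], [F], and these are entries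
    of [X]. *)
Lemma rep_bound : exists2 M : C, 0 <= M & forall (X : 'M[C]_2) e, sl2 X ->
  (forall i j, `|X i j| <= e) -> forall i j, `|theta X i j| <= M * e.
Proof.
pose H : 'M[C]_2 := delta_mx 0 0 - delta_mx 1 1.
pose E : 'M[C]_2 := delta_mx 0 1; pose F : 'M[C]_2 := delta_mx 1 0.
have sH : sl2 H by apply/sl2E; rewrite !mxE /= add0r subr0.
have sE : sl2 E by apply/sl2E; rewrite !mxE /= oppr0.
have sF : sl2 F by apply/sl2E; rewrite !mxE /= oppr0.
exists (\sum_i \sum_j (`|theta H i j| + `|theta E i j| + `|theta F i j|)).
  by do 2!apply: sumr_ge0 => ? _; rewrite !addr_ge0.
move=> X e sX Xe i j.
have -> : X = 1 *: (X 0 0 *: H + X 0 1 *: E) + X 1 0 *: F.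
  rewrite scale1r; apply: mx2P; rewrite !mxE ?sl2_11 //=; ring.
rewrite hth.1 //; last exact: sl2DZ.
rewrite hth.1 // scale1r.
have e0 : 0 <= e by exact: le_trans (Xe 0 0).
pose S i j := `|theta H i j| + `|theta E i j| + `|theta F i j|.
have S0 k l : 0 <= S k l by rewrite !addr_ge0.
apply: (@le_trans _ _ (S i j * e)); last first.
  apply: ler_wpM2r => //; rewrite (bigD1 i) //= (bigD1 j) //= -/(S i j) -addrA.
  rewrite lerDl addr_ge0 //; first by apply: sumr_ge0 => l _; apply: S0.
  by apply: sumr_ge0 => k _; apply: sumr_ge0 => l _; apply: S0.
rewrite !mxE !mulrDl; apply: le_trans (ler_normD _ _) _; apply: lerD.
  apply: le_trans (ler_normD _ _) _.
  by apply: lerD; rewrite normrM mulrC ler_wpM2l.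
by rewrite normrM mulrC ler_wpM2l.
Qed.

(** Supplies the invertibility in [bounds_expN] for all small connections at once, with [w x] for
    [X]. *)
Lemma resonance_radius p : exists2 e : C, 0 < e &
  exists rs : 'I_n -> seq C,
  (forall x (a : Defs.form n 'cV[C]_m p), lie_der_prod c x (rs x) a = 0) /\
  forall X : 'M[C]_2, sl2 X -> (forall i j, `|X i j| <= e) ->
    forall x r, r \in rs x -> r != 0 -> theta X + r%:M \in unitmx.
Proof.
have [rs hrs] := fin_all_exists (fun x => lie_der_roots c m x p).
have hg x : exists g, 0 < g /\ forall r, r \in rs x -> r != 0 -> g <= `|r|.
  by have [g g0 hg] := roots_gap (rs x); exists g.
have [g hg'] := fin_all_exists hg.
have [z z0 hz] := pos_lower_bound (fun x => (hg' x).1).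
have [M M0 hM] := rep_bound.
have mM0 : 0 < m%:R * M + 1 :> C by rewrite ltr_wpDl // mulr_ge0.
(* Adding 1 keeps the denominator positive and the final inequality strict. *)
exists (z / (m%:R * M + 1)); first exact: divr_gt0.
exists rs; split=> // X sX Xe x r rx r0.
apply: (small_shift_unitmx r0 (hM X _ sX Xe)).
apply: lt_le_trans (le_trans (hz x) ((hg' x).2 r rx r0)).
rewrite mulrA mulrCA gtr_pMr // ltr_pdivrMr // mul1r.
by rewrite ltrDl ltr01.
Qed.

Lemma Hnz_dtw (w : 'I_n -> 'M[C]_2) eta N i : (forall b, theta (w b) = eta b *: N) ->
  Hnz (fun k => @dtw C n c m theta w k) i <-> Hnz (fun k => @twd C n c eta m N k) i.
Proof.
move=> hw; have -> : (fun k => @dtw C n c m theta w k) = (fun k => @twd C n c eta m N k).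
  by apply: functional_extensionality_dep => k; apply: funext => a; exact: dtwE.
by [].
Qed.

Lemma resonance_germ i : (0 < m)%N -> exists2 e : C, 0 < e &
  forall w : 'I_n -> 'M[C]_2, (forall a i j, `|w a i j| < e) ->
  (~ Hh_nz c i -> ~ Res c theta i w) /\
  (Hh_nz c i -> (Res c theta i w <-> coneSdet c theta w)).
Proof.
move=> m0; have [e1 e1_gt0 he1] := MC_germ hL.
have [e2 e2_gt0 [rs [hrs hU]]] := resonance_radius i.
have [e [e_gt0 ee1 ee2]] := pos_lower_bound2 e1_gt0 e2_gt0.
exists e => // w we.
have MCw : MC c w <-> coneS c w.
  by apply: he1 => a k l; apply: lt_le_trans (we a k l) ee1.
have sdet eta (g : 'M[C]_2) : closed1 c eta -> sl2 g -> \det (theta g) = 0 ->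
    (forall a, w a = eta a *: g) -> Hh_nz c i -> Res c theta i w.
  move=> etac sg dg hw hH; split; first by apply/MCw; exists eta, g.
  apply/(Hnz_dtw (eta := eta) (N := theta g)) => [b|]; first by rewrite hw rep_scale.
  by apply: twd_singular => //; apply/closed1P.
have cone_unit eta (g : 'M[C]_2) x : sl2 g -> (forall a, w a = eta a *: g) ->
    forall r, r \in rs x -> r != 0 -> eta x *: theta g + r%:M \in unitmx.
  move=> sg hw r rx r0; rewrite -rep_scale // -hw; apply: hU rx r0.
    by rewrite hw /sl2 mxtraceZ sg mulr0.
  by move=> k l; apply: le_trans (ltW (we x k l)) ee2.
split=> [hH [/MCw[eta [g [etac [sg hw]]]]]|hH].
  have hw' b : theta (w b) = eta b *: theta g by rewrite hw rep_scale.
  case: i hH rs hrs hU {sdet} cone_unit => [|p] hH rs hrs hU cone_unit.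
    (* [H^0(h)] is never zero: the constant cochain 1 is a cocycle. *)
    case: hH; exists (fun=> 1); split; first exact/alternatingP.
    split=> [x|]; first by rewrite /ce_d !big_ord1 big1 // => j; rewrite (ord1 j).
    have y : 'I_0 -> 'I_n by case.
    by exists y; rewrite oner_eq0.
  move=> hnz.
  have [[x etax]|eta0] := pselect (exists x, eta x != 0).
    have := (Hnz_dtw p.+1 hw').1 hnz.
    apply: twd_acyclic hH (hrs x) etax _ => //; first exact/closed1P.
    exact: cone_unit.
  have etaz b : eta b = 0.
    by apply/eqP; apply: contrapT => /negP h; apply: eta0; exists b.
  have hw0 b : theta (w b) = eta b *: 0 by rewrite hw' etaz scale0r scaler0.
  have := (Hnz_dtw p.+1 hw0).1 hnz.
  by apply: twd0_acyclic hH => //; apply/closed1P.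
split=> [[/MCw[eta [g [etac [sg hw]]]] hnz]|[eta [g [etac [sg [dg hw]]]]]]; last first.
  exact: sdet hw hH.
have [dg|dg] := eqVneq (\det (theta g)) 0; first by exists eta, g.
(* For invertible [theta g], either [eta = 0] and [w] is the vertex of the cone, or the cohomology
   vanishes. *)
have [[x etax]|eta0] := pselect (exists x, eta x != 0); last first.
  apply: zero_coneSdet => // a; rewrite hw (_ : eta a = 0) ?scale0r //.
  by apply/eqP; apply: contrapT => /negP h; apply: eta0; exists a.
have NU : theta g \in unitmx by rewrite unitmxE unitfE.
have hw' b : theta (w b) = eta b *: theta g by rewrite hw rep_scale.
have := (Hnz_dtw i hw').1 hnz.
case: i {hH sdet hnz} rs hrs hU cone_unit => [|p] rs hrs hU cone_unit.
  by move/(twd_unit_acyclic0 NU etax).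
move/(twd_unit_acyclic hL (iffLR (closed1P c eta) etac) NU (hrs x) etax); case.
exact: cone_unit.
Qed.

End Germs.

Theorem theorem4p7 (R : realType) (n : nat) (c : 'I_n -> 'I_n -> 'I_n -> R[i])
  (hL : is_lie c) (m : nat) (theta : 'M[R[i]]_2 -> 'M[R[i]]_m)
  (hth : sl2_rep theta) (hm : (0 < m)%N) :
  (H1_zero c ->
     germ_eq (MC c) (@set_zero R[i] n) /\
     forall i : nat,
       (~ Hh_nz c i -> germ_eq (Res c theta i) (@set_empty R[i] n)) /\
       (Hh_nz c i -> germ_eq (Res c theta i) (@set_zero R[i] n)))
  /\
  (~ H1_zero c ->
     germ_eq (MC c) (coneS c) /\
     forall i : nat,
       (~ Hh_nz c i -> germ_eq (Res c theta i) (@set_empty R[i] n)) /\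
       (Hh_nz c i -> germ_eq (Res c theta i) (coneSdet c theta))).
Proof.
have [e1 e1_gt0 he1] := MC_germ hL.
have empty i : ~ Hh_nz c i -> germ_eq (Res c theta i) (@set_empty R[i] n).
  move=> hH; have [e e0 he] := resonance_germ hL hth i hm.
  exists e; split=> // w we; split=> // hw.
  exact: ((he w we).1 hH hw).
have det i : Hh_nz c i -> germ_eq (Res c theta i) (coneSdet c theta).
  move=> hH; have [e e0 he] := resonance_germ hL hth i hm.
  by exists e; split=> // w we; apply: ((he w we).2 hH).
split=> [H1|_]; last first.
  by split; [exists e1|move=> i; split; [exact: empty|exact: det]].
(* With [H^1(h) = 0] both cones shrink to their vertex, so the germs already found become [{0}]. *)
have cone_zero (w : 'I_n -> 'M[R[i]]_2) : coneS c w -> set_zero w.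
  by case=> eta [g [etac [_ hw]]] a; rewrite hw (H1 eta etac) scale0r.
have coneSdetW (w : 'I_n -> 'M[R[i]]_2) : coneSdet c theta w -> coneS c w.
  by case=> eta [g [etac [sg [_ hw]]]]; exists eta, g.
split.
  exists e1; split=> // w we; split=> [/(he1 w we)|w0]; first exact: cone_zero.
  exact/(he1 w we)/coneSdetW/(zero_coneSdet _ hth).
move=> i; split=> [|/det [e [e0 he]]]; first exact: empty.
exists e; split=> // w we; split=> [/(he w we)/coneSdetW|w0]; first exact: cone_zero.
exact/(he w we)/(zero_coneSdet _ hth).
Qed.
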